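(* Let $n\ge1$, and for a positive integer $N=2^{l}(2s+1)$ with integers $l,s\ge0$ put $\mu_N=h_l(0)$ if $s=0$ and $\mu_N=h_l(0)\star(2,1^{2(s-1)})$ if $s>0$. Consider the following procedure. Start with $\alpha=\mu_n$. As long as the current sequence $\alpha$ is not $(n-1)$, do the following: (a) obtain $\alpha'\in L_n$ by applying one elementary operation $\mathcal{E}_s$ or $\mathcal{E}_c$ on the tail of the longest left sequence of $\alpha$ of even length which gives a lexical successor in $L_n$ (that is, on cell $i$ of $\alpha$, where $i$ is the largest even index for which the elementary operation on cell $i$ yields an element of $L_n$); (b) compute $f=\alpha\wedge\alpha'\in L_m$ and divide $n=dm+r$, $0\le r<m$; (c) if $r>0$, the next sequence is $\alpha'$; if $r=0$, the next sequence is $f\star\mu_d$. Then $\mu_n$ is the least element of $L_n$, the procedure ends at the maximal element $(n-1)$ of $L_n$, and it produces all elements of $L_n$ in increasing order, each sequence produced being adjacent in $L_n$ to the next one.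
   Context: An $\alpha$-sequence is a finite sequence $\alpha=(\alpha_1,\dots,\alpha_k)$ of positive integers; in addition the one-term sequence $(0)$ is admitted. Its length is $l(\alpha)=k$ and its degree is $D(\alpha)=\sum_{i=1}^k\alpha_i$. A left sequence of $\alpha$ is $(\alpha_1,\dots,\alpha_i)$, $1\le i\le k$, and its tail is $\alpha_i$. Order. For $\tau=(\tau_1,\dots,\tau_k)$ put $Al(\tau)=(\tau_1,-\tau_2,\tau_3,\dots,(-1)^{k-1}\tau_k,0,0,\dots)$. For $\tau\ne\tau'$ write $\tau>\tau'$ if the first nonzero term of $Al(\tau)-Al(\tau')$ is positive, and $\tau<\tau'$ if it is negative. This is a total order. If $\alpha<\beta$, $\beta$ is called a successor of $\alpha$. For elements of a set $S$, ''$\alpha$ is adjacent to $\beta$ in $S$'' means $\alpha<\beta$ and there is no $\gamma\in S$ with $\alpha<\gamma<\beta$. A sequence $\alpha=(\alpha_1,\dots,\alpha_k)$ is lexical if $\alpha>(\alpha_i,\dots,\alpha_k)$ for all $2\le i\le k$. $L_n$ is the set of lexical sequences $\alpha$ with $1+D(\alpha)=n$; in particular $L_1=\{(0)\}$. Elementary operations. The $i$-th place of $\alpha$ is called its $i$-th cell, with value $\alpha_i$. The elementary operation on cell $i$ is: if $\alpha_i>1$, splitting $\mathcal{E}_s$, which gives $(\alpha_1,\dots,\alpha_{i-1},\alpha_i-1,1,\alpha_{i+1},\dots,\alpha_k)$; if $\alpha_i=1$ (and $i\ge2$), conjugation $\mathcal{E}_c$, which gives $(\alpha_1,\dots,\alpha_{i-2},\alpha_{i-1}+1,\alpha_{i+1},\dots,\alpha_k)$.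 Wedge. $\alpha\wedge\alpha=\alpha$; for $\alpha\ne\beta$, if $i$ is the first place with $\alpha_i\neq\beta_i$, then $\alpha\wedge\beta=(\alpha_1,\dots,\alpha_{i-1},\min(\alpha_i,\beta_i))$. Products and harmonics. $\alpha\beta$ is concatenation, $\alpha^q$ is $\alpha$ repeated $q$ times ($\alpha^0$ is empty), and $1^q$ means $1$ repeated $q$ times. For $\alpha=(\alpha_1,\dots,\alpha_k)$: if $k$ is even, $\alpha_e=(\alpha_1,\dots,\alpha_k+1)$ and $\alpha_o=(\alpha_1,\dots,\alpha_k,1)$; if $k$ is odd, $\alpha_e=(\alpha_1,\dots,\alpha_k,1)$ and $\alpha_o=(\alpha_1,\dots,\alpha_k+1)$. The star product of $\alpha$ and $\beta=(\beta_1,\dots,\beta_k)$ is $\alpha\star\beta=\alpha_o(\alpha_e)^{\beta_1-1}\alpha_o(\alpha_e)^{\beta_2-1}\cdots\alpha_o(\alpha_e)^{\beta_k-1}\alpha$, with the convention $(0)\star\beta=\beta$. The harmonics of $(0)$ are $h_0(0)=(0)$, $h_1(0)=(1)$, and $h_j(0)=(h_{j-1}(0))_o\,h_{j-1}(0)$ for $j\ge2$; so $h_2(0)=(2,1)$, $h_3(0)=(2,1,1,2,1)$. *)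

(* Defs.v *)
From mathcomp Require Import all_boot all_order all_algebra.

Set Implicit Arguments.
Unset Strict Implicit.
Unset Printing Implicit Defensive.

Import Order.TTheory GRing.Theory Num.Theory.

(* Cells are numbered from 1, whereas the positions used by [nth], [take],
   [drop] and [Al] are numbered from 0. *)

(* The empty list is excluded: otherwise it would belong to L_1. *)
Definition alpha_seq (a : seq nat) : bool :=
  (a == [:: 0]) || (a != [::]) && all (fun x => 0 < x) a.

Definition degree (a : seq nat) : nat := sumn a.

(* Term number j + 1 of Al(a), whence the sign (-1)^j. *)
Definition Al (a : seq nat) (j : nat) : int := ((-1) ^+ j * (nth 0%N a j)%:Z)%R.

(* Position of the first nonzero term of Al(a) - Al(b).  When there is none,
   [find] returns a position at which both Al(a) and Al(b) are 0. *)
Definition first_nz (a b : seq nat) : nat :=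
  find (fun j => Al a j - Al b j != 0)%R (iota 0 (maxn (size a) (size b))).

Definition alt_lt (a b : seq nat) : bool :=
  (0 < Al b (first_nz b a) - Al a (first_nz b a))%R.

Definition alt_le (a b : seq nat) : bool := (a == b) || alt_lt a b.

Definition adjacent (S : {pred seq nat}) (a b : seq nat) : Prop :=
  alt_lt a b /\ ~ (exists2 c, c \in S & alt_lt a c && alt_lt c b).

Definition least (S : {pred seq nat}) (a : seq nat) : Prop :=
  a \in S /\ (forall b, b \in S -> alt_le a b).

Definition greatest (S : {pred seq nat}) (a : seq nat) : Prop :=
  a \in S /\ (forall b, b \in S -> alt_le b a).

(* [drop j a] with 1 <= j < k is (a_i, ..., a_k) with i = j + 1. *)
Definition lexical (a : seq nat) : bool :=
  alpha_seq a && all (fun j => alt_lt (drop j a) a) (iota 1 (size a).-1).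

Definition L (n : nat) : {pred seq nat} :=
  [pred a | lexical a && (1 + degree a == n)].

Definition cell (a : seq nat) (i : nat) : nat := nth 0 a i.-1.

Definition splitting (i : nat) (a : seq nat) : seq nat :=
  take i.-1 a ++ [:: (cell a i).-1, 1 & drop i a].

Definition conjugation (i : nat) (a : seq nat) : seq nat :=
  take i.-2 a ++ (cell a i.-1).+1 :: drop i a.

(* [None] when there is no elementary operation on cell [i]; in particular
   when [a] has no [i]-th cell. *)
Definition elem_op (i : nat) (a : seq nat) : option (seq nat) :=
  if (0 < i) && (1 < cell a i) then Some (splitting i a)
  else if (1 < i) && (cell a i == 1) then Some (conjugation i a)
  else None.

(* Missing cells count as 0.  This convention is never used for distinct
   alpha-sequences of equal degree, as neither is then a prefix of the other. *)
Definition wedge (a b : seq nat) : seq nat :=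
  if a == b then a else
  let j := find (fun j => nth 0 a j != nth 0 b j)
                (iota 0 (maxn (size a) (size b))) in
  rcons (take j a) (minn (nth 0 a j) (nth 0 b j)).

(* (a_1, ..., a_k + 1) *)
Definition incr_last (a : seq nat) : seq nat :=
  rcons (take (size a).-1 a) (last 0 a).+1.

Definition seq_e (a : seq nat) : seq nat :=
  if odd (size a) then rcons a 1 else incr_last a.

Definition seq_o (a : seq nat) : seq nat :=
  if odd (size a) then incr_last a else rcons a 1.

Definition pow (a : seq nat) (q : nat) : seq nat := flatten (nseq q a).

(* Meaningful for [b] with positive terms, or for [a] = (0). *)
Definition star (a b : seq nat) : seq nat :=
  if a == [:: 0] then b
  else flatten [seq seq_o a ++ pow (seq_e a) x.-1 | x <- b] ++ a.

Fixpoint harmonic (j : nat) : seq nat :=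
  match j with
  | 0 => [:: 0]
  | 1 => [:: 1]
  | i.+1 => seq_o (harmonic i) ++ harmonic i
  end.

Definition mu_of (l s : nat) : seq nat :=
  if s == 0 then harmonic l
  else star (harmonic l) (2 :: nseq (2 * (s - 1)) 1).

(* For N > 0, N = 2^l (2 s + 1) with l and s as below; see [muE]. *)
Definition mu (N : nat) : seq nat :=
  let l := logn 2 N in mu_of l (N %/ 2 ^ l)./2.

Lemma muE (l s : nat) : mu (2 ^ l * (2 * s + 1)) = mu_of l s.
Proof.
rewrite /mu lognM ?expn_gt0 ?addn1 // pfactorK //.
have -> : logn 2 (2 * s).+1 = 0.
  by apply: logn_coprime; rewrite coprime2n /= mul2n odd_double.
by rewrite addn0 mulKn ?expn_gt0 //= mul2n uphalf_double.
Qed.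

Definition op_in_L (n : nat) (a : seq nat) (i : nat) : bool :=
  if elem_op i a is Some a' then a' \in L n else false.

(* The largest even i for which the elementary operation on cell i of [a]
   yields an element of L_n, or 0 if there is none. *)
Definition step_cell (n : nat) (a : seq nat) : nat :=
  last 0 [seq i <- iota 1 (size a) | ~~ odd i && op_in_L n a i].

(* The sequence alpha' of step (a); [None] if [step_cell n a] is 0. *)
Definition step_op (n : nat) (a : seq nat) : option (seq nat) :=
  elem_op (step_cell n a) a.

(* Steps (b) and (c), with m = 1 + degree f. *)
Definition step_next (n : nat) (a a' : seq nat) : seq nat :=
  let f := wedge a a' in
  let m := 1 + degree f in
  if 0 < n %% m then a' else star f (mu (n %/ m)).

Definition next_seq (n : nat) (a : seq nat) : option (seq nat) :=
  omap (step_next n a) (step_op n a).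

(* [s] lists, in order of production, the sequences of a complete run of the
   procedure: it starts at mu_n and stops at (n - 1). *)
Definition complete_run (n : nat) (s : seq (seq nat)) : Prop :=
  [/\ ohead s = Some (mu n),
      sorted (fun a b => (a != [:: n.-1]) && (next_seq n a == Some b)) s &
      last [::] s = [:: n.-1]].

(* Main.v *)
Require Import Defs.
From mathcomp Require Import all_boot all_order all_algebra.
From mathcomp Require Import zify.

Set Implicit Arguments.
Unset Strict Implicit.
Unset Printing Implicit Defensive.

Import Order.TTheory GRing.Theory Num.Theory.

(* A sequence (a_1, a_2, ...) is encoded by its word: a_1 letters 1, then a_2
   letters -1, then a_3 letters 1, and so on, closed by a letter 0.  The order of
   sequences becomes the lexicographic order for -1 < 0 < 1, a sequence is lexical
   when its word exceeds all its proper suffixes and their negatives, an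
   elementary operation on an even cell negates the word from a letter -1 on, the
   wedge is the longest common prefix, and [f * b] inserts the letters of [b]
   between copies of [f] and of [-f].

   Let [x < y] be consecutive lexical words of length [n], and [f] the common
   prefix, of length [p]; it is lexical.  Write [x = f (-1) X].  A lexical word
   that starts with [f 1] is either a product [f * b] or greater than all of them.
   The main point is that a word [Y] with [X < Y < f (-1) f (-1) ...] all of whose
   suffixes and negated suffixes are less than [f 1 (-X)] leads to a lexical word
   of length [n] between [x] and [f 1 ...]: cutting maximal suffixes off [Y]
   writes [n] as a sum of lengths of lexical words between [x] and [f 1], and
   these words can be glued.  As nothing lies between [x] and [y], such a [Y] does
   not exist, which forces [f 1 (-X)] to be lexical.  Then [y = f 1 (-X)] if [p]
   does not divide [n], and otherwise [y] is the least product [f * b]. *)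

(** * Words and their order *)

(** An operation on an even cell turns the last letter -1 of the cell into 1, so it raises the word,
    and it raises it the less, the later the cell stands. A lexical result beyond the first
    difference [d] of [x] and [y] would therefore lie between them. So step (a) finds [d], provided
    that [d] ends a cell of [x] and that the flip at [d] is lexical even when the successor is a
    product. In that case [y] tells nothing about [X]. A tail [U] of length [p], built from the
    longest border of [f 1], replaces the tail of [y]: either [-X <= U], and [f 1 (-X)] inherits the
    conditions on its prefix from [f 1 U], or [-U] preceded by copies of [f (-1)] is a forbidden
    [Y]. The bound [f (-1) f (-1) ...] comes from the supremum of the products [f * b]: after [f 1],
    that supremum continues with the negative of this periodic word. The form of mu comes from the
    same dichotomy: a lexical word of length above 2 begins with [1 1], so it is a product with left
    factor [1 0] or exceeds all of these. Iteration uses up the factors 2 of the length; an odd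
    length leaves (2, 1, ..., 1). *)

Definition ltw (u v : nat -> int) : Prop :=
  exists2 d, (forall i, i < d -> u i = v i) & (u d < v d)%R.

Definition lew (u v : nat -> int) : Prop := u =1 v \/ ltw u v.

Definition sh (j : nat) (u : nat -> int) : nat -> int := fun i => u (j + i).

Definition tw (b : bool) (u : nat -> int) : nat -> int :=
  fun i => (if b then - u i else u i)%R.

Definition cut (d : nat) (u : nat -> int) : nat -> int :=
  fun i => if i < d then u i else 0%R.

(* The length [n] of a word counts its final 0. *)
Definition sgnw (n : nat) (u : nat -> int) : Prop :=
  (forall i, i < n.-1 -> u i = 1%R \/ u i = (-1)%R) /\
  (forall i, n.-1 <= i -> u i = 0%R).

(** The range includes [j = n - 1], the suffix made of the closing 0 alone, which forces the first
    letter to be 1 when [n > 1]. *)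
Definition lexw (n : nat) (u : nat -> int) : Prop :=
  sgnw n u /\ forall b j, 0 < j < n -> ltw (tw b (sh j u)) u.

Lemma ltw_irr u : ~ ltw u u.
Proof. by case=> d _; rewrite ltxx. Qed.

Lemma ltw_trans v u w : ltw u v -> ltw v w -> ltw u w.
Proof.
move=> [d1 e1 l1] [d2 e2 l2]; case: (ltngtP d1 d2) => h.
- exists d1 => [i hi|]; first by rewrite e1 // e2 //; lia.
  by rewrite -e2.
- exists d2 => [i hi|]; last by rewrite e1.
  by rewrite e1 ?e2 //; lia.
- subst d2; exists d1 => [i hi|]; first by rewrite e1 ?e2.
  by apply: lt_trans l2.
Qed.

Lemma ltw_asym u v : ltw u v -> ltw v u -> False.
Proof. by move=> h1 h2; apply: (@ltw_irr u); apply: ltw_trans h2. Qed.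

Lemma ltw_ext u u' v v' : u =1 u' -> v =1 v' -> ltw u v -> ltw u' v'.
Proof.
by move=> e1 e2 [d h1 h2]; exists d => [i /h1|]; rewrite -e1 -e2.
Qed.

Lemma lew_trans v u w : lew u v -> lew v w -> lew u w.
Proof.
move=> [e|h] [e'|h']; [left|right|right|right].
- by move=> i; rewrite e e'.
- by apply: ltw_ext h' => // i; rewrite e.
- by apply: ltw_ext h.
- by apply: ltw_trans h'.
Qed.

Lemma lew_ltw_trans v u w : lew u v -> ltw v w -> ltw u w.
Proof.
case=> [e h|h h']; last by apply: ltw_trans h'.
by apply: ltw_ext h => // i; rewrite e.
Qed.

Lemma ltw_lew_trans v u w : ltw u v -> lew v w -> ltw u w.
Proof. by move=> h [e|h']; [apply: ltw_ext h|apply: ltw_trans h']. Qed.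

Lemma ltw_diff u v i : u i <> v i -> ltw u v \/ ltw v u.
Proof.
move=> hi; have ex : exists i, u i != v i by exists i; apply/eqP.
case: (ex_minnP ex) => d /eqP hd hm.
have eqd k : k < d -> u k = v k.
  by move=> hk; apply/eqP/negPn/negP => /hm; rewrite leqNgt hk.
case: (ltgtP (u d) (v d)) => h; [left|right|by case: hd].
  by exists d.
by exists d => // k hk; rewrite eqd.
Qed.

Lemma ltw_tri n m u v : sgnw n u -> sgnw m v -> [\/ u =1 v, ltw u v | ltw v u].
Proof.
move=> [_ hu] [_ hv].
have [/forallP h|] := boolP [forall i : 'I_(n + m), u i == v i].
  constructor 1 => i; case: (ltnP i (n + m)) => hi.
    exact: (eqP (h (Ordinal hi))).
  by rewrite hu ?hv //; lia.
move=> /forallPn [i /eqP /ltw_diff [] h]; [by constructor 2|by constructor 3].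
Qed.

Lemma ltwN u v : ltw u v -> ltw (tw true v) (tw true u).
Proof. by case=> d h1 h2; exists d => [i /h1|]; rewrite /tw; [move=> ->|lia]. Qed.

Lemma ltw_sh k u v : (forall i, i < k -> u i = v i) ->
  (ltw (sh k u) (sh k v) <-> ltw u v).
Proof.
move=> e; split=> -[d h1 h2].
  exists (k + d) => // i hi; case: (ltnP i k) => [/e //|hk].
  by have := h1 (i - k); rewrite /sh subnKC //; apply; lia.
have hd : k <= d by rewrite leqNgt; apply/negP => /e h; rewrite h ltxx in h2.
exists (d - k) => [i hi|]; rewrite /sh; last by rewrite subnKC.
by apply: h1; lia.
Qed.

Lemma sgnw_tw n u b : sgnw n u -> sgnw n (tw b u).
Proof.
move=> [h1 h2]; split=> i hi; rewrite /tw.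
  by case: b; case: (h1 i hi) => ->; rewrite ?opprK; auto.
by rewrite h2 //; case: b; rewrite ?oppr0.
Qed.

Lemma sgnw_sh n u j : sgnw n u -> sgnw (n - j) (sh j u).
Proof. by move=> [h1 h2]; split=> i hi; rewrite /sh; [apply: h1|apply: h2]; lia. Qed.

Lemma sgnw_le1 n u i : sgnw n u -> (-1 <= u i <= 1)%R.
Proof.
move=> [h1 h2]; case: (ltnP i n.-1) => hi; last by rewrite h2.
by case: (h1 i hi) => ->.
Qed.

Lemma sgnw_cut n d u : sgnw n u -> d < n -> sgnw d.+1 (cut d u).
Proof.
move=> [h1 _] hd; split=> i /= hi; rewrite /cut.
  by rewrite hi; apply: h1; lia.
by rewrite ltnNge hi.
Qed.

Lemma lexw_head n u : lexw n u -> 1 < n -> u 0 = 1%R.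
Proof.
move=> [[h1 h2] h] hn; have [|d e l] := h false n.-1; first lia.
have z i : tw false (sh n.-1 u) i = 0%R by rewrite /tw /sh h2 //; lia.
case: (h1 0) => //; first lia.
move=> h0; case: d e l => [|d] e; rewrite z ?h0 // => _.
by have := e 0 isT; rewrite z h0.
Qed.

Lemma lexw_sh_lt n u b j : lexw n u -> 1 < n -> 0 < j -> ltw (tw b (sh j u)) u.
Proof.
move=> hL hn hj; case: (ltnP j n) => hjn; first by apply: hL.2; rewrite hj.
exists 0 => //; rewrite (lexw_head hL hn) /tw /sh hL.1.2; last lia.
by case: b.
Qed.

(** When a signed suffix of the common prefix runs into its closing 0, the letter facing that 0 must
    be 1. Were it -1, lexicality of [x] and of [y] would force the signed letters of both at [d] to
    be -1, but these letters are opposite. *)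
Lemma lexw_cut n x y d : lexw n x -> lexw n y ->
  (forall i, i < d -> x i = y i) -> (x d < y d)%R ->
  [/\ d < n.-1, x d = (-1)%R, y d = 1%R & lexw d.+1 (cut d x)].
Proof.
move=> Lx Ly e l.
have hd : d < n.-1.
  by rewrite ltnNge; apply/negP => h; rewrite Lx.1.2 ?Ly.1.2 // in l.
have [xd yd] : x d = (-1)%R /\ y d = 1%R.
  by case: (Lx.1.1 d hd) l => ->; case: (Ly.1.1 d hd) => -> //.
split=> //; have Wc : sgnw d.+1 (cut d x) by apply: sgnw_cut Lx.1 _; lia.
split=> // b j /andP [j0 jd].
have hn : 1 < n by lia.
have [k1 a1 b1] := lexw_sh_lt b Lx hn j0.
have [k2 a2 b2] := lexw_sh_lt b Ly hn j0.
have cx i : i < d -> cut d x i = x i by rewrite /cut => ->.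
have cd : cut d x d = 0%R by rewrite /cut ltnn.
case: (ltnP k1 (d - j)) => hk.
  exists k1 => [i hi|]; rewrite /tw /sh ?cx; try lia.
    by have := a1 i hi; rewrite /tw /sh.
  by move: b1; rewrite /tw /sh.
exists (d - j) => [i hi|].
  rewrite /tw /sh !cx; try lia.
  by have := a1 i; rewrite /tw /sh; apply; lia.
rewrite /tw /sh subnKC; last lia.
rewrite cd cx; last lia.
have xdj := Lx.1.1 (d - j) ltac:(lia).
suff : x (d - j) <> (-1)%R by case: xdj => // -> _; case: (b).
move=> ex.
have ey : y (d - j) = (-1)%R by rewrite -e //; lia.
have l1 : (tw b (sh j x) (d - j)%N <= x (d - j)%N)%R.
  by case: (ltngtP k1 (d - j)) hk => // [h _|h _]; [rewrite a1|rewrite -h ltW].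
have l2 : (tw b (sh j y) (d - j)%N <= y (d - j)%N)%R.
  have hk2 : d - j <= k2.
    rewrite leqNgt; apply/negP => h.
    have := a1 k2 ltac:(lia); move: b2; rewrite /tw /sh -!e; lia.
  by case: (ltngtP k2 (d - j)) hk2 => // [h _|h _]; [rewrite a2|rewrite -h ltW].
move: l1 l2; rewrite /tw /sh subnKC; last lia.
by rewrite xd yd ex ey; case: (b).
Qed.

(** * Star product of words *)

(* [starw p f b] is [f b_0 (-b_0 f) b_1 (-b_1 f) ...]; the length [p] of [f]
   includes the final 0, whose place is taken by the letters of [b]. *)
Definition starw (p : nat) (f b : nat -> int) : nat -> int := fun i =>
  if i %% p == p.-1 then b (i %/ p)
  else if i < p then f i else (- b (i %/ p).-1 * f (i %% p)%N)%R.

Lemma starw_last p f b a : 0 < p -> starw p f b (a * p + p.-1) = b a.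
Proof.
move=> hp; have h : p.-1 < p by lia.
by rewrite /starw modnMDl modn_small // eqxx divnMDl // divn_small // addn0.
Qed.

Lemma starw_first p f b r : r < p.-1 -> starw p f b r = f r.
Proof.
by move=> h; rewrite /starw modn_small; last lia; rewrite ltn_eqF //; case: ifP => //; lia.
Qed.

Lemma starw_mid p f b a r : r < p.-1 -> starw p f b (a.+1 * p + r) = (- b a * f r)%R.
Proof.
move=> h; have h' : r < p by lia.
rewrite /starw modnMDl modn_small // ltn_eqF // divnMDl; last lia.
rewrite divn_small // addn0; case: ifP => //.
by rewrite mulSn; lia.
Qed.

Lemma blockP p i : 0 < p -> exists a r, r < p /\ i = a * p + r.
Proof. by move=> hp; exists (i %/ p), (i %% p); rewrite ltn_mod hp -divn_eq. Qed.

Lemma block_lt p a r a' r' : r < p -> r' < p ->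
  a' * p + r' < a * p + r -> a' < a \/ a' = a /\ r' < r.
Proof.
move=> h h' l; case: (ltngtP a' a) => e; [by left| |by right; split=> //; lia].
have : a.+1 * p <= a' * p by rewrite leq_mul2r e orbT.
by rewrite mulSn; lia.
Qed.

Lemma starw_mono p f b b' : 0 < p -> ltw b b' -> ltw (starw p f b) (starw p f b').
Proof.
move=> hp [k e l]; exists (k * p + p.-1); last by rewrite !starw_last.
move=> i; have [a [r [hr ->]]] := blockP i hp => hlt.
have h := @block_lt p k p.-1 a r ltac:(lia) hr hlt.
have [er|hr'] : r = p.-1 \/ r < p.-1 by lia.
  by subst r; rewrite !starw_last // e //; lia.
case: a h {hlt} => [|a] h; first by rewrite mul0n add0n !starw_first.
by rewrite !starw_mid // e //; lia.
Qed.

Lemma starw_ext p f b b' : b =1 b' -> starw p f b =1 starw p f b'.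
Proof. by move=> e i; rewrite /starw !e. Qed.

Lemma starw_star_sgnw p d f b : 1 < p -> 0 < d -> sgnw p f -> sgnw d b ->
  sgnw (d * p) (starw p f b).
Proof.
move=> hp hd [f1 f2] [b1 b2].
have pm a r : a < d.-1 -> r < p.-1 ->
    (- b a * f r)%R = 1%R \/ (- b a * f r)%R = (-1)%R.
  by move=> /b1 h /f1 h'; case: h => ->; case: h' => ->; auto.
split=> i; have [a [r [hr ->]]] := blockP i (ltnW hp) => hi.
  have [e|hr'] : r = p.-1 \/ r < p.-1 by lia.
    subst r; rewrite starw_last; last lia.
    apply: b1; have h : a * p + p.-1 < d.-1 * p + p.-1.
      by move: hi; rewrite -{1}(prednK hd) mulSn; lia.
    by have := @block_lt p d.-1 p.-1 a p.-1 ltac:(lia) ltac:(lia) h; lia.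
  case: a hi => [|a] hi; first by rewrite mul0n add0n starw_first //; apply: f1.
  rewrite starw_mid //; apply: pm => //.
  have h : a.+1 * p + r < d.-1 * p + p.-1.
    by move: hi; rewrite -{1}(prednK hd) mulSn; lia.
  by have := @block_lt p d.-1 p.-1 a.+1 r ltac:(lia) ltac:(lia) h; lia.
have h : (d.-1 * p + p.-1) < (a * p + r).+1.
  by move: hi; rewrite -{1}(prednK hd) mulSn; lia.
have h' : d.-1 < a \/ d.-1 = a /\ p.-1 <= r.
  move: h; rewrite ltnS leq_eqVlt => /orP [/eqP e|h].
    case: (ltngtP a d.-1) => ha; [|by left|by right; split=> //; subst a; lia].
    have : a.+1 * p <= d.-1 * p by rewrite leq_mul2r ha orbT.
    by rewrite mulSn; lia.
  by have := @block_lt p a r d.-1 p.-1 ltac:(lia) ltac:(lia) h; lia.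
have [e|hr'] : r = p.-1 \/ r < p.-1 by lia.
  by subst r; rewrite starw_last ?b2 //; lia.
case: a {hi} h h' => [|a] h h'; first lia.
by rewrite starw_mid // b2; [rewrite oppr0 mul0r|lia].
Qed.

(** A block carries the sign opposite to the letter before it, so the hypothesis on letter [a - 1]
    makes the signed suffix start with a copy of [f] itself. *)
Lemma starw_sh p f b a t : 0 < p -> 0 < a -> (tw t b a.-1 = -1)%R ->
  tw t (sh (a * p) (starw p f b)) =1 starw p f (tw t (sh a b)).
Proof.
move=> hp ha e i; have [a' [r [hr ->]]] := blockP i hp.
rewrite /tw /sh addnA -mulnDl.
have [->|hr'] : r = p.-1 \/ r < p.-1 by lia.
  by rewrite !starw_last.
case: a ha e => // a _ /= e; rewrite addSn starw_mid //.
case: a' => [|a'].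
  rewrite addn0 mul0n add0n starw_first //; move: e; rewrite /tw.
  by case: t => e; [have -> : b a = 1%R by lia|rewrite e]; rewrite ?mulN1r ?opprK ?mul1r.
rewrite starw_mid // addSnnS.
by case: (t); rewrite ?mulNr ?opprK.
Qed.

(** A signed suffix starting at a block is a product of [f] with a signed suffix of [b], or starts
    with -1. One starting inside a block is compared with [f] by lexicality of [f]; if this is
    undecided at the end of the block, the next letter of [b] decides, or else it has sign 1 and the
    block after it is [-f]. *)
Lemma starw_lexw p d f b : 1 < p -> 0 < d -> lexw p f -> lexw d b ->
  lexw (d * p) (starw p f b).
Proof.
move=> hp hd Lf Lb; have hp0 : 0 < p by lia.
have Ws := starw_star_sgnw hp hd Lf.1 Lb.1.
split=> // t j; have [a [r [hr ->]]] := blockP j hp0 => /andP [j0 jn].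
have f0 := lexw_head Lf hp.
have F0 i : i < p.-1 -> starw p f b i = f i by move=> h; rewrite starw_first.
have Flast : starw p f b p.-1 = b 0 by rewrite -(starw_last f b 0 hp0).
have ad : a < d.
  rewrite ltnNge; apply/negP => h.
  have : d * p <= a * p by rewrite leq_mul2r h orbT.
  lia.
case: r hr j0 jn => [|r] hr j0 jn.
  rewrite addn0 in j0 jn *.
  have a0 : 0 < a by case: a j0 {ad jn} => //; rewrite mul0n.
  have ba : b a.-1 = 1%R \/ b a.-1 = (-1)%R by apply: Lb.1.1; lia.
  have [e|e] : tw t b a.-1 = (-1)%R \/ tw t b a.-1 = 1%R.
    by rewrite /tw; case: t; case: ba => ->; auto.
    apply: (@ltw_ext (starw p f (tw t (sh a b)))) (starw_mono _ hp0 (Lb.2 t a _)) => //.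
      by move=> i; rewrite starw_sh.
    by rewrite a0.
  exists 0 => //; rewrite F0; last lia.
  rewrite f0 /tw /sh addn0; move: e; rewrite /tw.
  have -> : starw p f b (a * p) = (- b a.-1)%R.
    have := @starw_mid p f b a.-1 0; rewrite prednK // addn0 f0 mulr1; apply; lia.
  by case: t; lia.
pose e := if a == 0 then 1%R else (- b a.-1)%R.
have he : e = 1%R \/ e = (-1)%R.
  rewrite /e; case: eqP => [_|h]; first by left.
  by case: (Lb.1.1 a.-1) => [|->|->]; [lia|right|left].
have Fe i : i < p.-1 -> starw p f b (a * p + i) = (e * f i)%R.
  move=> hi; rewrite /e; case: a {e he j0 jn ad} => [|a] /=.
    by rewrite mul0n add0n F0 // mul1r.
  by rewrite starw_mid.
pose t' := t (+) (e == -1)%R.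
have tE i : (if t then - (e * f i) else e * f i)%R = tw t' f i.
  by rewrite /t' /tw; case: (t); case: he => -> //=; rewrite ?mul1r ?mulN1r ?opprK.
have [k k1 k2] := Lf.2 t' r.+1 ltac:(lia).
case: (ltnP k (p.-1 - r.+1)) => hk.
  exists k => [i hi|].
    rewrite /tw /sh -addnA Fe; last lia.
    by rewrite tE F0 -?k1 //; lia.
  rewrite /tw /sh -addnA Fe; last lia.
  by rewrite tE F0 //; lia.
have fz : f (r.+1 + (p.-1 - r.+1)) = 0%R by rewrite Lf.1.2 //; lia.
have kE : k = p.-1 - r.+1.
  apply/eqP; rewrite eqn_leq hk andbT leqNgt; apply/negP => h.
  have := k1 _ h; rewrite /tw /sh fz.
  by case: (Lf.1.1 (p.-1 - r.+1)) => [|->|->]; [lia|case: (t')|case: (t')].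
have fk : f k = 1%R.
  have := k2; rewrite kE /tw /sh fz.
  by case: (Lf.1.1 (p.-1 - r.+1)) => [|->|->]; [lia| |case: (t')].
have agr i : i < k -> tw t (sh (a * p + r.+1) (starw p f b)) i = starw p f b i.
  move=> hi; rewrite /tw /sh -addnA Fe; last lia.
  by rewrite tE F0 -?k1 //; lia.
have atk : tw t (sh (a * p + r.+1) (starw p f b)) k = tw t b a.
  by rewrite /tw /sh -addnA (_ : r.+1 + k = p.-1) ?starw_last //; lia.
have Fk : starw p f b k = 1%R by rewrite F0 //; lia.
have [h|h] : (tw t b a < 1)%R \/ tw t b a = 1%R.
  have := sgnw_le1 a (sgnw_tw t Lb.1); lia.
  by exists k => //; rewrite atk Fk.
have ad' : a < d.-1.
  rewrite ltnNge; apply/negP => h'; move: h; rewrite /tw Lb.1.2 //.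
  by case: (t).
have b0 : b 0 = 1%R by apply: lexw_head Lb _; lia.
(* The block that follows is [-f]; negating [- sh (k + 1) f < f] gives the required
   [-f < sh (k + 1) f]. *)
have [k' k1' k2'] := Lf.2 true k.+1 ltac:(lia).
have nxt i : i < p.-1 ->
    tw t (sh (a * p + r.+1) (starw p f b)) (k.+1 + i) = (- f i)%R.
  move=> hi; rewrite /tw /sh.
  rewrite (_ : a * p + r.+1 + (k.+1 + i) = a.+1 * p + i); last by rewrite mulSn; lia.
  rewrite starw_mid //; move: h; rewrite /tw.
  by case: (t) => h; [have -> : b a = (-1)%R by lia|rewrite h]; rewrite ?mulN1r ?opprK ?mul1r.
have hk' : k' <= p.-1 - k.+1.
  rewrite leqNgt; apply/negP => h'; have := k1' _ h'; rewrite /tw /sh Lf.1.2; last lia.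
  by case: (Lf.1.1 (p.-1 - k.+1)) => [|->|->]; [lia| |].
exists (k.+1 + k') => [i hi|].
  case: (ltngtP i k) => hik; first exact: agr.
    have -> : i = k.+1 + (i - k.+1) by lia.
    rewrite nxt; last lia.
    have := k1' (i - k.+1) ltac:(lia); rewrite /tw /sh F0; last lia.
    lia.
  by subst i; rewrite atk h Fk.
rewrite nxt; last lia.
case: (ltngtP k' (p.-1 - k.+1)) hk' => // hk' _.
  by rewrite F0; [move: k2'; rewrite /tw /sh|]; lia.
rewrite (_ : k.+1 + k' = p.-1); last lia.
rewrite Flast b0.
have : f (k.+1 + k') = 0%R by rewrite Lf.1.2 //; lia.
by move: k2'; rewrite /tw /sh => h1 h2; rewrite h2 in h1; lia.
Qed.

Lemma run_start (P : pred nat) j : P j -> exists a,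
  [/\ a <= j, forall i, a <= i <= j -> P i & a = 0 \/ 0 < a /\ ~~ P a.-1].
Proof.
elim: j => [|j IH] hj.
  by exists 0; split=> // [i|]; [rewrite leqn0 => /eqP -> |left].
case: (boolP (P j)) => h; last first.
  by exists j.+1; split=> // [i hi|]; [have -> : i = j.+1 by lia|right].
have [a [a1 a2 a3]] := IH h; exists a; split=> // [|i hi]; first lia.
by case: (ltngtP i j.+1) => [hi'|hi'|-> //]; [apply: a2|]; lia.
Qed.

Lemma run_end (P : pred nat) j k : P j -> ~~ P (j + k) -> exists e,
  [/\ j < e, forall i, j <= i < e -> P i & ~~ P e].
Proof.
move=> hj hk; have ex : exists i, ~~ P (j + i) by exists k.
case: (ex_minnP ex) => e he hm; exists (j + e); split=> //.
  by case: e he {hm} => [|e]; rewrite ?addn0 ?hj //; lia.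
move=> i hi; have := hm (i - j); rewrite subnKC; last lia.
by case: (P i) => // /(_ isT); lia.
Qed.

(** A signed suffix starting strictly inside a run of 1s has a shorter initial run than the suffix
    starting with that run, whose initial run is no longer than that of [b]. So only the starts of
    runs, that is the cells of a sequence, need a check. *)
Lemma lexw_of_runs d b : sgnw d b -> (1 < d -> b 0 = 1%R) ->
  (forall t j, 0 < j < d -> tw t b j.-1 = (-1)%R -> tw t b j = 1%R ->
     ltw (tw t (sh j b)) b) ->
  lexw d b.
Proof.
move=> Wb b0 hR; split=> // t j /andP [j0 jd].
have {}b0 : b 0 = 1%R by apply: b0; lia.
have Wt := sgnw_tw t Wb.
have [e|ne] := @eqP _ (tw t b j) 1%R; last first.
  by exists 0 => //; rewrite b0 /tw /sh addn0 -/(tw t b j); have := sgnw_le1 j Wt; lia.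
pose P i := tw t b i == 1%R.
have Pj : P j by apply/eqP.
have [a [a1 a2 a3]] := run_start Pj.
have Pz : ~~ P (j + d) by rewrite /P Wt.2 //; lia.
have [k [k1 k2 k3]] := run_end Pj Pz.
have ones : forall i, i < k - a -> b i = 1%R.
  have run i : i < k - a -> tw t b (a + i) = 1%R.
    by move=> hi; apply/eqP; case: (leqP (a + i) j) => h; [apply: a2|apply: k2]; lia.
  case: a3 => [ea|[a3 a4]].
    have : tw t b 0 = 1%R by have := run 0; rewrite ea; apply; lia.
    rewrite /tw; case: (t) run => [_|run _ i]; first by rewrite b0.
    by have := run i; rewrite ea.
  have am : tw t b a.-1 = (-1)%R.
    by move: a4; rewrite /P; case: (Wt.1 a.-1) => [|->|->] //; lia.
  have pa : tw t b a = 1%R by apply/eqP/a2; lia.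
  have [m m1 m2] := hR t a ltac:(lia) am pa.
  have E i : tw t (sh a b) i = tw t b (a + i) by [].
  have lm : k - a <= m.
    rewrite leqNgt; apply/negP => h; have := sgnw_le1 m Wb.
    by move: m2; rewrite E run //; lia.
  by move=> i hi; rewrite -m1 ?E ?run //; lia.
have [ej|nj] : a = j \/ a < j by lia.
  subst a; case: a3 => [|[_ a4]]; first lia.
  apply: hR => //; first by rewrite j0.
  by move: a4; rewrite /P; case: (Wt.1 j.-1) => [|->|->] //; lia.
have Ej i : tw t (sh j b) i = tw t b (j + i) by [].
exists (k - j) => [i hi|]; rewrite Ej ones; try lia.
  by apply/eqP/k2; lia.
by move/eqP: k3; rewrite subnKC; last lia; have := sgnw_le1 k Wt; lia.
Qed.

Lemma ltw_starw p f d d' b b' : 0 < p -> sgnw d b -> sgnw d' b' ->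
  ltw (starw p f b) (starw p f b') -> ltw b b'.
Proof.
move=> hp W W' h; have [e|//|h'] := ltw_tri W W'.
  by case: (@ltw_irr (starw p f b')); apply: ltw_ext h => //; apply: starw_ext.
by case: (ltw_asym h); apply: starw_mono.
Qed.

(* [starw p f (fun=> 1)] is the supremum of the words [f * b]. *)
Lemma star_or_gt p n f y : 1 < p -> lexw p f -> lexw n y ->
  (forall i, i < p.-1 -> y i = f i) -> y p.-1 = 1%R ->
  (exists d b, [/\ n = d * p, lexw d b & y =1 starw p f b]) \/
  ltw (starw p f (fun=> 1%R)) y.
Proof.
move=> hp Lf Ly e1 e2; have hp0 : 0 < p by lia.
have hpn : p.-1 < n.-1.
  by rewrite ltnNge; apply/negP => h; have := Ly.1.2 _ h; rewrite e2.
have hn : 1 < n by lia.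
set om := starw p f _; pose b i := y (i * p + p.-1).
have fn0 r : r < p.-1 -> f r = 1%R \/ f r = (-1)%R by apply: Lf.1.1.
have [h|lt] : ltw om y \/ ltw y om.
  have [a [r [hr En]]] := blockP n hp0.
  have : y n <> om n.
    rewrite Ly.1.2; last lia.
    have [er|hr'] : r = p.-1 \/ r < p.-1 by lia.
      by rewrite En er /om starw_last.
    case: a En => [|a] ->; rewrite /om.
      by rewrite mul0n add0n starw_first //; case: (fn0 r hr') => ->.
    by rewrite starw_mid //; case: (fn0 r hr') => ->.
  by move/ltw_diff => [|]; auto.
  by right.
left.
have y0 : b 0 = 1%R by rewrite /b mul0n add0n.
(* Suppose a first mismatch [k] in the block after letter [a], and extend the run of equal letters
   of [b] ending at [a] backwards to [a']. From block [a'] on, the signed word agrees with [om] up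
   to [k], and lexicality at the start of the mismatching block puts it above [om] at [k]. Thus a
   signed suffix of [y] exceeds [om], hence [y]. *)
have yfs : y =1 starw p f b.
  move=> i0; apply/eqP/negPn/negP => ne.
  have ex : exists i, y i != starw p f b i by exists i0.
  case: (ex_minnP ex) => k /eqP kne kmin {i0 ne ex}.
  have eqk i : i < k -> y i = starw p f b i.
    by move=> hi; apply/eqP/negPn/negP => /kmin; rewrite leqNgt hi.
  have [a [r [hr Ek]]] := blockP k hp0.
  have [er|hr'] : r = p.-1 \/ r < p.-1 by lia.
    by apply: kne; rewrite Ek er starw_last.
  case: a Ek => [|a] Ek.
    by apply: kne; rewrite Ek mul0n add0n starw_first // e1.
  have ba : b a = 1%R \/ b a = (-1)%R.
    apply: Ly.1.1; rewrite ltnNge; apply/negP => h.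
    by apply: kne; rewrite Ek starw_mid // /b !Ly.1.2 ?oppr0 ?mul0r //; lia.
  pose t := b a == (-1)%R.
  have ta : tw t b a == 1%R by rewrite /tw /t; case: ba => ->.
  have [a' [a1 a2 a3]] := run_start (P := fun i => tw t b i == 1%R) ta.
  have hle : a' * p <= a * p by rewrite leq_mul2r a1 orbT.
  have kp : k = (a * p + p) + r by rewrite Ek mulSn; lia.
  have a'k : a' * p < k by lia.
  have a3' : a' = 0 /\ t = false \/ 0 < a' /\ tw t b a'.-1 = (-1)%R.
    case: a3 => [a'0|[a'0 h]].
      left; split=> //; have := a2 0; rewrite a'0 /= => /(_ isT).
      by rewrite /tw y0; case: (t).
    right; split=> //; have : b a'.-1 = 1%R \/ b a'.-1 = (-1)%R.
      have : a'.-1 * p <= a * p by rewrite leq_mul2r; lia.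
      move=> hh; case: ba => hba; apply: Ly.1.1; rewrite ltnNge; apply/negP => h'.
        by move: hba; rewrite /b Ly.1.2 //; lia.
      by move: hba; rewrite /b Ly.1.2 //; lia.
    by move=> hb; move: h; rewrite /tw; case: (t); case: hb => ->.
  have agr i : i < k - a' * p -> tw t (sh (a' * p) y) i = om i.
    have om1 c : om (c * p + p.-1) = 1%R by rewrite /om starw_last.
    move=> hi; have -> : tw t (sh (a' * p) y) i = tw t (sh (a' * p) (starw p f b)) i.
      by rewrite /tw /sh eqk //; lia.
    transitivity (starw p f (tw t (sh a' b)) i).
      case: a3' => [[-> ->]|[h1 h2]]; last by rewrite starw_sh.
      by rewrite /tw /sh mul0n; apply: starw_ext => c; rewrite add0n.
    have [c [s [hs Ei]]] := blockP i hp0.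
    have one c' : c' <= a - a' -> tw t (sh a' b) c' = 1%R.
      by move=> h; apply/eqP/(a2 (a' + c')); lia.
    have bl := @block_lt p (a - a').+1 r c s hr hs.
    have kE : k - a' * p = (a - a').+1 * p + r by rewrite Ek -subSn // mulnBl; lia.
    rewrite -Ei -kE in bl; have {}bl := bl hi.
    have [es|hs'] : s = p.-1 \/ s < p.-1 by lia.
      by rewrite Ei es starw_last // om1; apply: one; lia.
    rewrite Ei; case: c {Ei} bl => [|c] bl.
      by rewrite mul0n add0n /om !starw_first.
    by rewrite /om !starw_mid // one //; lia.
  have yk : tw (~~ t) y k <> f r.
    move=> h; apply: kne; rewrite Ek starw_mid // -Ek.
    move: h ta; rewrite /tw; case: (t) => /= h /eqP h2.
      have -> : b a = (-1)%R by lia.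
      by rewrite opprK mul1r.
    by rewrite h2 mulN1r -h opprK.
  have shk : (forall i, i < r -> tw (~~ t) (sh (a.+1 * p) y) i = y i).
    move=> i hi; rewrite /tw /sh eqk; last lia.
    rewrite starw_mid ?e1; try lia.
    move/eqP: ta; rewrite /tw; case: (t) => /= h; last by rewrite h mulN1r opprK.
    have -> : b a = (-1)%R by lia.
    by rewrite opprK mul1r.
  have lek : (tw (~~ t) y k < f r)%R.
    case: (ltgtP (tw (~~ t) y k) (f r)) => // h; exfalso.
    apply: (ltw_asym (lexw_sh_lt (~~ t) (j := a.+1 * p) Ly hn _)).
      by rewrite muln_gt0.
    by exists r => [i /shk ->|] //; rewrite e1 // /tw /sh -Ek.
  have gt : ltw om (tw t (sh (a' * p) y)).
    exists (k - a' * p) => [i /agr ->|] //.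
    have -> : tw t (sh (a' * p) y) (k - a' * p) = tw t y k.
      by rewrite /tw /sh subnKC //; lia.
    have -> : k - a' * p = (a - a').+1 * p + r by rewrite Ek -subSn // mulnBl; lia.
    rewrite /om starw_mid //; move: lek; rewrite /tw; case: (t) => /=; lia.
  have := ltw_trans lt gt; case: a3' => [[-> ->]|[h1 h2]].
    move=> h; apply: (@ltw_irr y); apply: ltw_ext h => //.
  move=> h; apply: (ltw_asym h); apply: lexw_sh_lt Ly hn _.
  by rewrite muln_gt0 h1.
(* The closing 0 of [y] cannot fall inside a block, whose letters there are products of nonzero
   letters; so it is a letter of [b], and [p] divides [n]. *)
have [a [r [hr En]]] := blockP n.-1 hp0.
have rE : r = p.-1.
  apply/eqP; rewrite eqn_leq; apply/andP; split; first lia.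
  rewrite leqNgt; apply/negP => hr'.
  case: a En => [|a] En; first by move: En; rewrite mul0n; lia.
  have : y n.-1 = 0%R by apply: Ly.1.2.
  rewrite yfs En starw_mid //.
  have : b a = 1%R \/ b a = (-1)%R by apply: Ly.1.1; rewrite En mulSn; lia.
  by case=> ->; case: (fn0 r hr') => ->.
exists a.+1, b; split=> //; first by rewrite mulSn; lia.
have Wb : sgnw a.+1 b.
  split=> i /= hi; rewrite /b; [apply: Ly.1.1|apply: Ly.1.2]; rewrite En rE.
    have : i.+1 * p <= a * p by rewrite leq_mul2r hi orbT.
    by rewrite mulSn; lia.
  have : a * p <= i * p by rewrite leq_mul2r hi orbT.
  lia.
apply: lexw_of_runs => // t j hj h1 h2.
have j0 : 0 < j by lia.
apply: (ltw_starw (p := p) (f := f) (d := a.+1 - j) hp0 _ Wb).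
  exact/sgnw_tw/sgnw_sh.
have h := lexw_sh_lt t (j := j * p) Ly hn ltac:(by rewrite muln_gt0 j0).
apply: ltw_ext h => // i; rewrite -starw_sh // /tw /sh yfs //.
Qed.

(** * Lexical words with a given prefix *)

(* The word [f e u], with [e] in the place of the final zero of [f]. *)
Definition spl (p : nat) (f : nat -> int) (e : int) (u : nat -> int) : nat -> int :=
  fun i => if i < p.-1 then f i else if i == p.-1 then e else u (i - p).

(** The share of lexicality concerning the suffixes that start within [f e], to be handled
    separately from those that start in the tail. *)
Definition lexp (p : nat) (u : nat -> int) : Prop :=
  forall b j, 0 < j < p -> ltw (tw b (sh j u)) u.

Lemma spl_lo p f e u i : i < p.-1 -> spl p f e u i = f i.
Proof. by rewrite /spl => ->. Qed.

Lemma spl_mid p f e u : spl p f e u p.-1 = e.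
Proof. by rewrite /spl ltnn eqxx. Qed.

Lemma spl_hi p f e u i : 0 < p -> spl p f e u (p + i) = u i.
Proof.
move=> hp; rewrite /spl ifN ?ifN; last 2 first.
- by apply/eqP; lia.
- by lia.
by congr u; lia.
Qed.

Lemma splP p f e u x : 0 < p -> (forall i, i < p.-1 -> x i = f i) ->
  x p.-1 = e -> (forall i, x (p + i) = u i) -> x =1 spl p f e u.
Proof.
move=> hp h1 h2 h3 i; rewrite /spl; case: ltnP => [/h1 //|h].
by case: eqP => [->//|h']; rewrite -h3; congr x; lia.
Qed.

Lemma spl_lt p f u v e : 0 < p -> ltw u v -> ltw (spl p f e u) (spl p f e v).
Proof.
move=> hp [d h1 h2]; exists (p + d); last by rewrite !spl_hi.
move=> i hi; rewrite /spl; case: ltnP => // h; case: eqP => // h'.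
by apply: h1; lia.
Qed.

Lemma spl_lt_mid p f u v : ltw (spl p f (-1)%R u) (spl p f 1%R v).
Proof.
by exists p.-1 => [i hi|]; rewrite ?spl_mid // !spl_lo.
Qed.

Lemma spl_ltE p f e u v : 0 < p -> ltw (spl p f e u) (spl p f e v) -> ltw u v.
Proof.
move=> hp h; suff : ltw (sh p (spl p f e u)) (sh p (spl p f e v)).
  by apply: ltw_ext => i; rewrite /sh spl_hi.
apply/ltw_sh => // i hi; rewrite /spl; case: ltnP => // h'.
by rewrite (_ : i = p.-1) ?eqxx //; lia.
Qed.

Lemma spl_ext p f e u v : u =1 v -> spl p f e u =1 spl p f e v.
Proof. by move=> h i; rewrite /spl h. Qed.

(** The signed suffix loses against a letter 1 of [f], either by a letter -1 or, at [k = p - 1 - c],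
    by its closing 0. Only in the second case does it matter how [f] is continued. *)
Lemma lexw_suffix_diff p f c b : lexw p f -> 0 < c < p -> exists k,
  [/\ k <= p.-1 - c, forall i, i < k -> tw b (sh c f) i = f i,
      f k = 1%R & k < p.-1 - c -> tw b (sh c f) k = (-1)%R].
Proof.
move=> Lf hc; have [k k1 k2] := Lf.2 b c hc.
have z : tw b (sh c f) (p.-1 - c) = 0%R by rewrite /tw /sh Lf.1.2 ?oppr0 ?if_same //; lia.
have hk : k <= p.-1 - c.
  rewrite leqNgt; apply/negP => /k1; rewrite z.
  by case: (Lf.1.1 (p.-1 - c)) => [|->|->] //; lia.
have fk := Lf.1.1 k ltac:(lia).
case: (ltngtP k (p.-1 - c)) hk => // hk _.
  have [e|e] : tw b (sh c f) k = 1%R \/ tw b (sh c f) k = (-1)%R.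
  - by apply: (sgnw_tw b (sgnw_sh c Lf.1)).1; lia.
  - by move: k2; rewrite e; case: fk => ->.
  exists k; split=> //; first by rewrite ltnW.
  by move: k2; rewrite e; case: fk => ->.
exists k; split=> //; try lia.
by move: k2; rewrite hk z -hk; case: fk => ->.
Qed.

Definition mone (t : bool) : int := if t then (-1)%R else 1%R.

(** Let [d] be the first difference of [u] and [u']. On the right, letter [i] of the tail appears
    only at place [p - c + i > i], so both right sides agree up to [d], while the left side drops at
    [d]. *)
Lemma shift_interp p f e t c u u' : 0 < p -> c < p -> lew u u' ->
  ltw u' (sh c (spl p f e (tw t u'))) -> ltw u (sh c (spl p f e (tw t u))).
Proof.
move=> hp hc [e0 h|[d h1 h2] [k k1 k2]].
  by apply: ltw_ext h => [i|i]; rewrite ?e0 // /sh /spl /tw e0.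
have agr i : i <= d ->
    sh c (spl p f e (tw t u)) i = sh c (spl p f e (tw t u')) i.
  move=> hi; rewrite /sh /spl; case: ltnP => // h; case: eqP => // h'.
  by rewrite /tw h1 //; lia.
case: (ltnP k d) => hk.
  by exists k => [i hi|]; rewrite agr ?h1 //; [apply: k1|..]; lia.
exists d => [i hi|]; rewrite agr //; [|lia|].
  by rewrite h1 // k1 //; lia.
apply: lt_le_trans h2 _; move: hk; rewrite leq_eqVlt => /orP [/eqP ->|/k1 ->//].
exact: ltW.
Qed.

(** Interpolation: the condition passes to smaller tails after [f 1] and to larger ones after
    [f (-1)]. A signed suffix is still undecided at the tail only if it matches [f] to its end and
    its sign [b] turns the inserted letter into 1, that is [b = t]; then [shift_interp] applies. *)
Lemma lexp_interp p f t u u' : lexw p f -> lew (tw t u) (tw t u') ->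
  lexp p (spl p f (mone t) u') -> lexp p (spl p f (mone t) u).
Proof.
move=> Lf huu L' b c hc; have hp : 0 < p by lia.
have [k [k1 k2 k3 k4]] := lexw_suffix_diff b Lf hc.
have lo (v : nat -> int) i : i < p.-1 - c ->
    tw b (sh c (spl p f (mone t) v)) i = tw b (sh c f) i.
  by move=> hi; rewrite /tw /sh spl_lo //; lia.
case: (ltnP k (p.-1 - c)) => hk.
  exists k => [i hi|]; rewrite lo; try lia.
    by rewrite k2 // spl_lo //; lia.
  by rewrite k4 // spl_lo ?k3 //; lia.
have {k1 k4 hk} ek : k = p.-1 - c by lia.
have at_k v : tw b (sh c (spl p f (mone t) v)) k = tw b (fun=> mone t) 0.
  by rewrite /tw /sh (_ : c + k = p.-1) ?spl_mid //; lia.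
have agr v i : i < k -> tw b (sh c (spl p f (mone t) v)) i = spl p f (mone t) v i.
  by move=> hi; rewrite lo ?k2 ?spl_lo //; lia.
have [ebt|nbt] := eqVneq b t; last first.
  exists k => [i|]; first exact: agr.
  rewrite at_k spl_lo ?k3; last lia.
  by move: nbt; rewrite /tw /mone; case: (b); case: (t).
subst b; have agr' v i : i < k.+1 ->
    tw t (sh c (spl p f (mone t) v)) i = spl p f (mone t) v i.
  rewrite ltnS leq_eqVlt => /orP [/eqP ->|]; last exact: agr.
  rewrite at_k spl_lo ?k3; last lia.
  by rewrite /tw /mone; case: (t).
have shE v : sh k.+1 (tw t (sh c (spl p f (mone t) v))) =1 tw t v.
  by move=> i; rewrite /tw /sh (_ : c + (k.+1 + i) = p + i) ?spl_hi //; lia.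
have tt v : tw t (tw t v) =1 v by move=> i; rewrite /tw; case: (t); rewrite ?opprK.
apply/(ltw_sh (agr' u)).
have h0 : ltw (tw t u') (sh k.+1 (spl p f (mone t) (tw t (tw t u')))).
  apply: ltw_ext ((ltw_sh (agr' u')).2 (L' t c hc)); first exact: shE.
  by move=> i; rewrite /sh; apply: spl_ext => i'; rewrite tt.
have := shift_interp hp _ huu h0 => /(_ ltac:(lia)).
apply: ltw_ext => i; first by rewrite shE.
by rewrite /sh; apply: spl_ext => i'; rewrite tt.
Qed.

Lemma spl_sgnw p q f t u : 0 < p < q -> lexw p f -> sgnw (q - p) u ->
  sgnw q (spl p f (mone t) u).
Proof.
move=> hp Lf Wu; split=> i hi; rewrite /spl.
  case: ltnP => h; first by apply: Lf.1.1.
  case: eqP => h'; first by rewrite /mone; case: (t); auto.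
  by apply: Wu.1; lia.
by rewrite ifN ?ifN ?Wu.2 //; lia.
Qed.

Lemma spl_lexw p q f t u : 0 < p < q -> lexw p f -> sgnw (q - p) u ->
  lexp p (spl p f (mone t) u) ->
  (forall b i, i < q - p -> ltw (tw b (sh i u)) (spl p f (mone t) u)) ->
  lexw q (spl p f (mone t) u).
Proof.
move=> hp Lf Wu L1 L2; split; first exact: spl_sgnw.
move=> b j hj; case: (ltnP j p) => h; first by apply: L1; lia.
have := L2 b (j - p) ltac:(lia); apply: ltw_ext => // i.
by rewrite /tw /sh (_ : j + i = p + (j - p + i)) ?spl_hi; lia.
Qed.

Lemma lexw_lexp p q x : p <= q -> lexw q x -> lexp p x.
Proof. by move=> h [_ hx] b j hj; apply: hx; lia. Qed.

Lemma lexp_ext p u v : u =1 v -> lexp p u -> lexp p v.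
Proof.
by move=> e h b j /h hb; apply: ltw_ext (hb b) => // i; rewrite /tw /sh e.
Qed.

Lemma lexw_ext p u v : u =1 v -> lexw p u -> lexw p v.
Proof.
move=> e [[h1 h2] h]; split; last exact: lexp_ext h.
by split=> i; rewrite -e; auto.
Qed.

(** The last letter before the closing 0, taken with the sign that makes it 1, gives the suffix
    [1 0], which exceeds every word beginning with [1 (-1)]. *)
Lemma lexw_second n u : lexw n u -> 2 < n -> u 1 = 1%R.
Proof.
move=> Lu hn; have u2 := Lu.1.1 (n - 2) ltac:(lia).
pose b := u (n - 2) == (-1)%R.
have [k k1 k2] := Lu.2 b (n - 2) ltac:(lia).
have z0 : tw b (sh (n - 2) u) 0 = 1%R.
  by rewrite /b /tw /sh addn0; case: u2 => ->.
have z1 : tw b (sh (n - 2) u) 1 = 0%R.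
  by rewrite /tw /sh Lu.1.2 ?oppr0 ?if_same //; lia.
have u1 := Lu.1.1 1 ltac:(lia).
case: k k1 k2 => [|[|k]] k1; rewrite ?z1.
- by rewrite z0 (lexw_head Lu) //; lia.
- by case: u1 => ->.
- by have := k1 1 isT; rewrite z1; case: u1 => ->.
Qed.

(** * Borders *)

(* [pad p f] is the word [f 1]; its borders correspond to its periods [c]. *)
Definition pad (p : nat) (f : nat -> int) : nat -> int :=
  fun i => if i < p.-1 then f i else 1%R.

Definition period (p : nat) (u : nat -> int) (c : nat) : bool :=
  (0 < c < p) && [forall i : 'I_p, (c + i < p) ==> (u (c + i) == u i)].

Lemma periodP p u c : reflect (0 < c < p /\ forall i, c + i < p -> u (c + i) = u i)
  (period p u c).
Proof.
apply: (iffP andP) => -[h1 h2]; split=> //.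
  move=> i hi; have hp : i < p by lia.
  by have := implyP (forallP h2 (Ordinal hp)) hi => /eqP.
by apply/forallP => i; apply/implyP => /h2 ->.
Qed.

Lemma pad_pm1 p f i : lexw p f -> pad p f i = 1%R \/ pad p f i = (-1)%R.
Proof. by move=> Lf; rewrite /pad; case: ltnP; [apply: Lf.1.1|left]. Qed.

Lemma pad_neg_suffix p f c : lexw p f -> 0 < c < p -> exists k,
  [/\ c + k < p, forall i, i < k -> (- pad p f (c + i) = pad p f i)%R,
      pad p f (c + k) = 1%R & pad p f k = 1%R].
Proof.
move=> Lf hc; have [k [k1 k2 k3 k4]] := lexw_suffix_diff true Lf hc.
exists k; split; first lia.
- move=> i hi; rewrite /pad ifT ?ifT; try lia.
  by have := k2 i hi.
- rewrite /pad; case: ltnP => // h; have := k4 ltac:(lia).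
  by rewrite /tw /sh => /eqP; rewrite eqr_opp => /eqP.
- by rewrite /pad; case: ltnP.
Qed.

Lemma pad_pos_suffix p f c : lexw p f -> 0 < c < p ->
  (exists k, [/\ c + k < p.-1, forall i, i < k -> pad p f (c + i) = pad p f i,
      pad p f (c + k) = (-1)%R & pad p f k = 1%R]) \/ period p (pad p f) c.
Proof.
move=> Lf hc; have [k [k1 k2 k3 k4]] := lexw_suffix_diff false Lf hc.
have agr i : i < k -> pad p f (c + i) = pad p f i.
  move=> hi; rewrite /pad ifT ?ifT; try lia.
  by have := k2 i hi.
have pk : pad p f k = 1%R by rewrite /pad; case: ltnP.
case: (ltnP k (p.-1 - c)) => hk; [left|right].
  exists k; split=> //; first lia.
  by rewrite /pad ifT; [apply: k4|lia].
apply/periodP; split=> // i hi; case: (ltnP i k) => [/agr //|h].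
have -> : i = k by lia.
by rewrite pk /pad ifF //; lia.
Qed.

Lemma neg_border_false p f j : lexw p f -> period p (pad p f) j ->
  p - j + (p - j) < p ->
  (forall i, i < p - j -> pad p f (p - j + i) = (- pad p f i)%R) -> False.
Proof.
move=> Lf /periodP [hj per] hq neg.
have hp : 1 < p by lia.
have padE i : i < p.-1 -> pad p f i = f i by rewrite /pad => ->.
have [q1|q1] : p - j = 1 \/ 1 < p - j by lia.
  have := neg 0; rewrite q1 addn0 padE ?padE; try lia.
  by rewrite (lexw_second Lf) ?(lexw_head Lf) //; lia.
set q := p - j in neg hq q1; have qE : q = p - j by []; clearbody q.
have gE i : i < q.-1 -> cut q.-1 f i = f i by rewrite /cut => ->.
have fq : f q.-1 = 1%R.
  have qp : q.-1 < p.-1 by lia.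
  rewrite -padE // -(per q.-1); last by lia.
  by rewrite /pad ifF //; apply/negbTE; lia.
have Wg : sgnw q (cut q.-1 f).
  by have := sgnw_cut Lf.1 (d := q.-1) ltac:(lia); rewrite prednK; last lia.
have Lg : lexw q (cut q.-1 f).
  split=> // b c hc.
  have E i : tw b (sh c (cut q.-1 f)) i = tw b (sh (j + c) f) i.
    rewrite /tw /sh; suff -> : cut q.-1 f (c + i) = f (j + c + i) by [].
    rewrite /cut; case: ltnP => h; last by rewrite Lf.1.2 //; lia.
    rewrite -addnA -padE; last by lia.
    by rewrite -per ?padE //; lia.
  have [k [k1 k2 k3 k4]] := lexw_suffix_diff b Lf (c := j + c) ltac:(lia).
  exists k => [i hi|]; rewrite E gE; try lia.
    by apply: k2.
  case: (ltnP k (p.-1 - (j + c))) => h; first by rewrite k4 ?k3.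
  by rewrite k3 /tw /sh Lf.1.2 ?oppr0 ?if_same //; lia.
have fE i : q <= i < q + q -> f i = (- pad p f (i - q))%R.
  by move=> hi; rewrite -padE -?neg ?subnKC //; lia.
have f2 : f (1 * q + q.-1) = (-1)%R.
  rewrite mul1n fE; last lia.
  by rewrite addKn padE ?fq //; lia.
have := star_or_gt q1 Lg Lf (fun i hi => esym (gE i hi)) fq.
case=> [[d [b [e1 e2 e3]]]|h].
  have hd : 2 < d.
    by rewrite ltnNge; apply/negP; rewrite -(leq_pmul2r (m := q)) //; lia.
  have := lexw_second e2 hd; rewrite -(starw_last (cut q.-1 f) b 1 (ltnW q1)) -e3.
  by rewrite f2.
apply: (ltw_asym h); exists (1 * q + q.-1); last by rewrite f2 starw_last //; lia.
move=> i; have [a [r [hr ->]]] := blockP i (ltnW q1) => hi.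
have := @block_lt q 1 q.-1 a r ltac:(lia) hr hi.
case: a {hi} => [|[|a]] [h1|[h1 h2]] //.
  have [er|er] : r = q.-1 \/ r < q.-1 by lia.
    by rewrite er starw_last; [rewrite mul0n add0n|lia].
  by rewrite mul0n add0n starw_first // gE.
rewrite starw_mid // gE // mul1n fE; last lia.
by rewrite addKn padE ?mulN1r //; lia.
Qed.

(* With [v 1] the longest border of [f 1 = v 1 w], the witness is
   [w (-v) 0]. *)
Lemma free_tail p f : 1 < p -> lexw p f -> exists U,
  [/\ sgnw p U, lexp p (spl p f 1%R U),
      forall b i Z, ltw (tw b (sh i U)) (spl p f 1%R Z) &
      exists k, [/\ k < p.-1, forall i, i < k -> (- U i = f i)%R, U k = 1%R & f k = 1%R]].
Proof.
move=> hp Lf; set F := pad p f.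
have Fpm i : F i = 1%R \/ F i = (-1)%R by apply: pad_pm1.
have F0 : F 0 = 1%R by rewrite /F /pad; case: ltnP => // _; apply: lexw_head Lf hp.
have FE i : i < p.-1 -> F i = f i by rewrite /F /pad => ->.
have NS c := @pad_neg_suffix p f c Lf; rewrite -/F in NS.
have PS c := @pad_pos_suffix p f c Lf; rewrite -/F in PS.
have Flast : F p.-1 = 1%R by rewrite /F /pad ltnn.
have ex : exists c, period p F c.
  exists p.-1; apply/periodP; split; first lia.
  by move=> i hi; rewrite (_ : i = 0) ?addn0 ?Flast ?F0 //; lia.
case: (ex_minnP ex) => j /[dup] pj /periodP [hj per] jmin {ex}.
pose U i : int := if i < j then F (p - j + i) else if i < p.-1 then (- F (i - j)%N)%R else 0%R.
have Ulo i : i < j -> U i = F (p - j + i) by rewrite /U => ->.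
have Uhi i : j + i < p.-1 -> U (j + i) = (- F i)%R.
  by move=> h; rewrite /U ifF ?h ?addKn //; lia.
have Uend i : p.-1 <= i -> U i = 0%R.
  by move=> h; rewrite /U ifF ?ifF //; lia.
have spF Z i : i < p -> spl p f 1%R Z i = F i.
  by move=> h; rewrite /spl /F /pad; case: ltnP => // h'; rewrite ifT //; lia.
(* The part [(-v) 0] of [U] loses against what follows a border of length [p - c] in [F]. Otherwise
   the negative of [v 1] would occur in [F] at [p - c], which [neg_border_false] excludes for
   [c = j] and the period [j] excludes for [c > j]. *)
have K c : period p F c -> exists k, [/\ p - c + k < p,
    forall i, i < k -> U (j + i) = F (p - c + i) & (U (j + k)%N < F (p - c + k)%N)%R].
  move=> /[dup] pc /periodP [hc perc]; have hjc := jmin c pc.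
  have [k [k1 k2 k3 k4]] := NS (p - c) ltac:(lia).
  case: (leqP k (p.-1 - j)) => hk.
    exists k; split=> //.
      by move=> i hi; rewrite Uhi; [have := k2 i hi|]; lia.
    rewrite k3; case: (ltnP (j + k) p.-1) => h; last by rewrite Uend.
    by rewrite Uhi // k4.
  exfalso; have neg i : i < p - j -> F (p - c + i) = (- F i)%R.
    by move=> hi; have := k2 i ltac:(lia); lia.
  have [ec|hcj] : c = j \/ j < c by lia.
    by subst c; apply: (neg_border_false Lf pj) => //; lia.
  have [k' [l1 l2 l3 l4]] := NS (p - c + j) ltac:(lia).
  move: l3; rewrite -addnA [j + _]addnC addnA addnC per; last lia.
  by rewrite neg ?l4 //; lia.
(* By the period [j], the word [U] coincides with [-f] from place [j] on. Before [j] it runs through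
   a suffix of [F], and [K] takes over when that suffix is a border. *)
have Bst b i Z : ltw (tw b (sh i U)) (spl p f 1%R Z).
  case: (ltnP i j) => hij; last first.
    case: (ltnP i p.-1) => hip; last first.
      by exists 0 => //; rewrite spF ?F0 /tw /sh ?Uend ?oppr0 ?if_same //; lia.
    have E x : tw b (sh i U) x = tw (~~ b) (sh i f) x.
      rewrite /tw /sh; suff -> : U (i + x) = (- f (i + x)%N)%R.
        by case: (b); rewrite ?opprK.
      case: (ltnP (i + x) p.-1) => h; last by rewrite Uend ?Lf.1.2 ?oppr0.
      have -> : i + x = j + (i - j + x) by lia.
      by rewrite Uhi -?FE; [rewrite per| |]; lia.
    have [k [k1 k2 k3 k4]] := lexw_suffix_diff (~~ b) Lf (c := i) ltac:(lia).
    exists k => [x hx|]; rewrite E spF ?FE; try lia.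
      exact: k2.
    case: (ltnP k (p.-1 - i)) => h; first by rewrite k4 ?k3.
    by rewrite k3 /tw /sh Lf.1.2 ?oppr0 ?if_same //; lia.
  case: b.
    have [k [k1 k2 k3 k4]] := NS (p - j + i) ltac:(lia).
    exists k => [x hx|]; rewrite spF; try lia; rewrite /tw /sh Ulo ?addnA; try lia.
    by rewrite k2.
  case: (PS (p - j + i)); first lia.
    move=> [k [k1 k2 k3 k4]].
    exists k => [x hx|]; rewrite spF; try lia; rewrite /tw /sh Ulo ?addnA; try lia.
    by rewrite k2.
  move=> pc; have [k [k1 k2 k3]] := K _ pc; move/periodP: pc => [_ perc].
  exists (p - (p - j + i) + k) => [x hx|].
    rewrite spF; last lia.
    rewrite /tw /sh; case: (ltnP (i + x) j) => h.
      by rewrite Ulo ?addnA ?perc //; lia.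
    have -> : i + x = j + (i + x - j) by lia.
    by rewrite k2; [congr F|]; lia.
  rewrite spF; last lia.
  by rewrite /tw /sh (_ : i + _ = j + k) //; lia.
exists U; split=> //.
- split=> i hi; last exact: Uend.
  case: (ltnP i j) => h; first by rewrite Ulo.
  have -> : i = j + (i - j) by lia.
  by rewrite Uhi; [case: (Fpm (i - j)) => ->; auto|lia].
- move=> b c hc; case: b.
    have [k [k1 k2 k3 k4]] := NS _ hc.
    exists k => [x hx|]; rewrite /tw /sh !spF; try lia.
    exact: k2.
  case: (PS _ hc).
    move=> [k [k1 k2 k3 k4]].
    exists k => [x hx|]; rewrite /tw /sh !spF; try lia.
    exact: k2.
  move=> pc; have hjc := jmin c pc; have [k [k1 k2 k3]] := K _ pc.
  move/periodP: pc => [_ perc].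
  have agr x : x < p - c -> tw false (sh c (spl p f 1%R U)) x = spl p f 1%R U x.
    by move=> hx; rewrite /tw /sh !spF ?perc //; lia.
  have shE x : tw false (sh c (spl p f 1%R U)) (p - c + x) = U x.
    by rewrite /tw /sh (_ : c + _ = p + x) ?spl_hi //; lia.
  (* For [c = j] the suffix agrees with all of [f 1], and then [(-v) 0] meets [w], which is [K]. For
     [c > j] it is [w] that meets [F] from [p - c] on, which amounts to comparing [F] with its own
     suffix at [c - j]. *)
  have [ec|hcj] : c = j \/ j < c by lia.
    subst c; exists (p - j + (j + k)) => [x hx|].
      case: (ltnP x (p - j)) => h; first exact: agr.
      have -> : x = p - j + (x - (p - j)) by lia.
      rewrite shE; case: (ltnP (x - (p - j)) j) => h'; first by rewrite spF ?Ulo //; lia.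
      have -> : x - (p - j) = j + (x - p) by lia.
      rewrite k2; last lia.
      by rewrite (_ : _ + (j + _) = p + (x - p)) ?spl_hi ?Ulo //; lia.
    rewrite shE (_ : p - j + (j + k) = p + k) ?spl_hi; try lia.
    by rewrite (Ulo k) //; lia.
  have shj m : m < p - c -> F (c - j + m) = F m.
    move=> hm; rewrite -(perc m); last lia.
    by rewrite (_ : c + m = j + (c - j + m)) ?per //; lia.
  have UF m : m < j -> U m = F (c - j + (p - c + m)).
    by move=> hm; rewrite Ulo //; congr F; lia.
  case: (PS (c - j)); first lia.
    move=> [m [m1 m2 m3 m4]].
    have hm : p - c <= m.
      by rewrite leqNgt; apply/negP => /shj; rewrite m3 m4.
    exists m => [x hx|].
      case: (ltnP x (p - c)) => h; first exact: agr.
      have -> : x = p - c + (x - (p - c)) by lia.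
      rewrite shE UF ?spF; try lia.
      by rewrite m2 //; lia.
    have -> : m = p - c + (m - (p - c)) by lia.
    rewrite shE UF ?spF; try lia.
    by rewrite subnKC // m3 m4.
  move=> /periodP [_ per'].
  have [k' [l1 l2 l3 l4]] := NS (p - c + j) ltac:(lia).
  exists (p - c + (j + k')) => [x hx|].
    case: (ltnP x (p - c)) => h; first exact: agr.
    have -> : x = p - c + (x - (p - c)) by lia.
    rewrite shE; case: (ltnP (x - (p - c)) j) => h'.
      by rewrite UF ?spF ?per' //; lia.
    have -> : x - (p - c) = j + (x - (p - c) - j) by lia.
    rewrite Uhi; last lia.
    rewrite spF; last lia.
    have := l2 (x - (p - c) - j) ltac:(lia); move=> <-; rewrite opprK; congr F; lia.
  rewrite shE Uhi ?spF; try lia.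
  by rewrite addnA l3 l4.
- have [k [k1 k2 k3 k4]] := NS (p - j) ltac:(lia).
  exists k; split; first lia.
  + move=> i hi; rewrite -FE; last lia.
    by have := k2 i hi; rewrite Ulo //; lia.
  + by rewrite Ulo ?k3 //; lia.
  + by rewrite -FE ?k4 //; lia.
Qed.

(** * Decomposition of a candidate *)

Definition per0 (p : nat) (f : nat -> int) : nat -> int :=
  fun i => if i %% p == p.-1 then (-1)%R else f (i %% p)%N.

Lemma per0E p f : 0 < p -> per0 p f =1 spl p f (-1)%R (per0 p f).
Proof.
move=> hp; apply: splP => // [i hi||i].
- by rewrite /per0 modn_small ?ifF //; lia.
- by rewrite /per0 modn_small ?eqxx //; lia.
- by rewrite /per0 modnDl.
Qed.

Lemma per0_sh p f a : sh (a * p) (per0 p f) =1 per0 p f.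
Proof. by move=> i; rewrite /sh /per0 modnMDl. Qed.

Lemma starw_onesE p f : 0 < p ->
  starw p f (fun=> 1%R) =1 spl p f 1%R (tw true (per0 p f)).
Proof.
move=> hp k; have [a [r [hr ->]]] := blockP k hp.
have [er|er] : r = p.-1 \/ r < p.-1 by lia.
  rewrite er starw_last //; case: a => [|a]; first by rewrite mul0n add0n spl_mid.
  by rewrite mulSn -addnA spl_hi // /tw /per0 modnMDl modn_small ?eqxx ?opprK //; lia.
case: a => [|a]; first by rewrite mul0n add0n starw_first ?spl_lo.
rewrite starw_mid // mulSn -addnA spl_hi // /tw /per0 modnMDl modn_small; last lia.
by rewrite ifF ?mulN1r //; lia.
Qed.

(** Before the first difference, [D] satisfies the recursion that defines the periodic word, so
    [f (-1) D] agrees with the latter up to and including that place. *)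
Lemma lt_per0 p f D : 0 < p -> ltw D (spl p f (-1)%R D) -> ltw D (per0 p f).
Proof.
move=> hp [k h1 h2].
have agr i : i <= k -> spl p f (-1)%R D i = per0 p f i.
  elim/ltn_ind: i => i IH hi; rewrite (per0E f hp) /spl.
  case: ltnP => // h; case: eqP => // h'.
  by rewrite h1 ?IH //; lia.
by exists k => [i hi|]; rewrite -agr //; [apply: h1|lia].
Qed.

Lemma squeeze p f X Z b : ltw (spl p f (-1)%R X) b -> ltw b (spl p f 1%R Z) ->
  forall i, i < p.-1 -> b i = f i.
Proof.
move=> [d1 e1 l1] [d2 e2 l2] i hi.
suff hd : p.-1 <= d1 by rewrite -e1 ?spl_lo //; lia.
rewrite leqNgt; apply/negP => hd; move: l1; rewrite spl_lo // => l1.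
case: (ltngtP d1 d2) => h.
- by move: l1; rewrite e2 // spl_lo // ltxx.
- by move: l2; rewrite -e1 // !spl_lo ?ltxx //; lia.
- by move: l2; rewrite -h spl_lo //; lia.
Qed.

Lemma max_orbit l Y : 0 < l -> sgnw l Y -> exists b i, i < l /\
  forall b' i', i' < l -> lew (tw b' (sh i' Y)) (tw b (sh i Y)).
Proof.
move=> hl WY; have W b i := sgnw_tw b (sgnw_sh i WY).
suff H (s : seq (bool * nat)) : s != [::] -> exists2 c, c \in s &
    forall c', c' \in s -> lew (tw c'.1 (sh c'.2 Y)) (tw c.1 (sh c.2 Y)).
  have [|[b i] h1 h2] := H [seq (b, i) | b <- [:: true; false], i <- iota 0 l].
    by case: (l) hl.
  have mem b' i' : i' < l -> (b', i') \in [seq (b, i) | b <- [:: true; false], i <- iota 0 l].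
    by move=> h; apply/allpairsP; exists (b', i'); rewrite mem_iota; split=> //; case: (b').
  exists b, i; split; last by move=> b' i' /(mem b') /h2.
  by move/allpairsP: h1 => [[b1 i1] /= [_]]; rewrite mem_iota => h [_ ->].
elim: s => // c [|c2 s] IH _.
  by exists c; rewrite ?mem_head // => c'; rewrite inE => /eqP ->; left.
have [//|c3 h1 h2] := IH.
have [h|h|h] := ltw_tri (W c.1 c.2) (W c3.1 c3.2).
- exists c3; first by rewrite inE h1 orbT.
  by move=> c'; rewrite inE => /orP [/eqP ->|/h2 //]; left.
- exists c3; first by rewrite inE h1 orbT.
  by move=> c'; rewrite inE => /orP [/eqP ->|/h2 //]; right.
exists c; first exact: mem_head.
move=> c'; rewrite inE => /orP [/eqP ->|/h2 h']; first by left.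
by apply: lew_trans h' _; right.
Qed.

Lemma sgnw_eq_size n m u v : sgnw n u -> sgnw m v -> 0 < n -> 0 < m -> u =1 v -> n = m.
Proof.
move=> Wu Wv hn hm e.
have H n' m' u' v' : sgnw n' u' -> sgnw m' v' -> 0 < n' -> u' =1 v' -> m' <= n'.
  move=> [_ h] [h' _] hn' e'; rewrite leqNgt; apply/negP => hl.
  have := h' n'.-1 ltac:(lia); rewrite -e' h //; by case.
apply/eqP; rewrite eqn_leq (H m n v u) // ?(H n m u v) // => i; by rewrite e.
Qed.

(* Tails [Y] such that [f (-1) Y] is a candidate for a lexical word of length
   [q] between [f (-1) X] and [f 1 (-X)]; it need not be lexical itself. *)
Definition cand (p : nat) (f X : nat -> int) (q : nat) (Y : nat -> int) : Prop :=
  [/\ p < q, sgnw (q - p) Y, ltw X Y, ltw Y (per0 p f) &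
      forall b i, ltw (tw b (sh i Y)) (spl p f 1%R (tw true X))].

(** Certificate that [q] is the length of some lexical word above [f (-1) X] that begins with
    [f (-1)]. A prime tail provides such a word directly, a sum stands for gluing, and [DecPeriod]
    for one more [f (-1)] in front of one of the words. Recording lengths only leaves the choice and
    the order of the words to the gluing. *)
Inductive decomp (p : nat) (f X : nat -> int) : nat -> Prop :=
| DecPrime q Y : p < q -> sgnw (q - p) Y -> ltw X Y ->
    (forall b i, ltw (tw b (sh i Y)) (spl p f (-1)%R X)) -> decomp p f X q
| DecSum q q' : decomp p f X q -> decomp p f X q' -> decomp p f X (q + q')
| DecPeriod q : decomp p f X q -> decomp p f X (q + p).

Lemma decomp_periods p f X q a : decomp p f X q -> decomp p f X (q + a * p).
Proof.
move=> h; elim: a => [|a IH]; first by rewrite addn0.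
by rewrite mulSn (addnC p) addnA; apply: DecPeriod.
Qed.

Lemma tw_tw b c u : tw b (tw c u) =1 tw (b (+) c) u.
Proof. by move=> i; rewrite /tw; case: b; case: c; rewrite ?opprK. Qed.

(** Strong induction on [q]. If the greatest signed suffix [be] of [Y] is below [x], then [Y] is
    prime. Otherwise [be] is lexical and lies between [x] and [f 1 (-X)]. Its tail is, up to sign, a
    shorter candidate, and so is the part [Y'] of [Y] left when [be] and the letter before it are
    removed; the exceptional cases only add multiples of [p]. *)
Lemma decomp_cand p n f X q Y : 1 < p -> lexw p f -> p < n ->
  lexw n (spl p f (-1)%R X) -> q <= n -> cand p f X q Y -> decomp p f X q.
Proof.
move=> hp Lf hpn Lx; have hp0 : 0 < p by lia.
set x := spl p f _ X in Lx *; set z := spl p f 1%R (tw true X).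
have hn : 1 < n by lia.
have x0 : x 0 = 1%R by apply: lexw_head Lx hn.
have z0 : z 0 = 1%R by rewrite -x0 /x /z !spl_lo //; lia.
have XE i : X i = x (p + i) by rewrite /x spl_hi.
elim/ltn_ind: q Y => q IH Y hqn [hpq WY XY YO YZ].
set l := q - p in WY; have hl : 0 < l by rewrite /l; lia.
have zero_lt b i : l.-1 <= i -> ltw (tw b (sh i Y)) x.
  by move=> hi; exists 0 => //; rewrite x0 /tw /sh WY.2 ?oppr0 ?if_same //; lia.
have [b [i [hi hmax]]] := max_orbit hl WY.
pose be := tw b (sh i Y); pose m := l - i; rewrite -/be in hmax.
have Wbe : sgnw m be by apply/sgnw_tw/sgnw_sh.
have m0 : 0 < m by rewrite /m; lia.
have [bx|xb] : ltw be x \/ ltw x be.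
  have [e|h|h] := ltw_tri Wbe Lx.1; [|by left|by right].
  by have := sgnw_eq_size Wbe Lx.1 m0 ltac:(lia) e; rewrite /m /l; lia.
  apply: (DecPrime hpq WY XY) => b' i'; case: (ltnP i' l) => h; last by apply: zero_lt; lia.
  exact: lew_ltw_trans (hmax b' i' h) bx.
have bz : ltw be z by apply: YZ.
have bef := squeeze xb bz.
have mp : p <= m.
  rewrite leqNgt; apply/negP => h; have := Wbe.2 m.-1 (leqnn _).
  by rewrite bef; [case: (Lf.1.1 m.-1) => [|->|->]; lia|lia].
have orb b' j : ltw (tw b' (sh j be)) z.
  by apply: ltw_ext (YZ (b' (+) b) (i + j)) => // k; rewrite -tw_tw /be /tw /sh addnA.
have Lbe : lexw m be.
  split=> // b' j hj.
  have e : tw b' (sh j be) =1 tw (b' (+) b) (sh (i + j) Y).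
    by move=> k; rewrite -tw_tw /be /tw /sh addnA.
  have [e'|h] := hmax (b' (+) b) (i + j) ltac:(rewrite /m in hj; lia); last first.
    by apply: ltw_ext h => // k; rewrite e.
  have := @sgnw_eq_size (m - j) m (tw b' (sh j be)) be.
  move=> /(_ (sgnw_tw _ (sgnw_sh _ Wbe)) Wbe ltac:(lia) m0) h.
  by have := h (fun k => etrans (e k) (e' k)); lia.
have beE e : be p.-1 = e -> be =1 spl p f e (sh p be).
  by move=> h; apply: splP.
have decM D : cand p f X m D -> decomp p f X m.
  by apply: IH; rewrite /m /l; lia.
have dec_m1 : be p.-1 = (-1)%R -> decomp p f X m.
  move=> h; have hm : p < m.
    by rewrite ltnNge; apply/negP => h'; have := Wbe.2 p.-1; rewrite h; lia.
  apply: (decM (sh p be)); split=> //.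
  - exact: sgnw_sh.
  - apply: (spl_ltE (p := p) (f := f) (e := (-1)%R) hp0).
    by apply: ltw_ext xb => // k; rewrite -beE.
  - apply: (lt_per0 hp0); have := lexw_sh_lt false Lbe ltac:(lia) hp0.
    by apply: ltw_ext => // k; rewrite -beE.
  - move=> b' j; have := orb b' (p + j).
    by apply: ltw_ext => // k; rewrite /tw /sh addnA.
(* The letter in the place of the closing 0 of [f] decides: 0 means [m = p], -1 makes the tail of
   [be] a candidate, and 1 makes [be] a product with left factor [f] or puts it above all of them,
   when its negated tail is a candidate. *)
have dec_m : decomp p f X m \/ exists2 e, 0 < e & m = e * p.
  have [e|[e|e]] : be p.-1 = 0%R \/ be p.-1 = (-1)%R \/ be p.-1 = 1%R.
  - by have := sgnw_le1 p.-1 Wbe; lia.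
  - right; exists 1 => //; rewrite mul1n; apply/eqP; rewrite eqn_leq mp andbT.
    rewrite leqNgt; apply/negP => h; case: (Wbe.1 p.-1); rewrite ?e //; lia.
  - by left; apply: dec_m1.
  have hm : p < m.
    by rewrite ltnNge; apply/negP => h'; have := Wbe.2 p.-1; rewrite e; lia.
  have [[d [b' [e1 e2 e3]]]|h] := star_or_gt hp Lf Lbe bef e.
    by right; exists d => //; case: (d) e1 => //; lia.
  left; apply: (decM (tw true (sh p be))); split=> //.
  - exact/sgnw_tw/sgnw_sh.
  - have : ltw (sh p be) (tw true X).
      apply: (spl_ltE (p := p) (f := f) (e := 1%R) hp0).
      by apply: ltw_ext bz => // k; rewrite -beE.
    by move/ltwN; apply: ltw_ext => // k; rewrite tw_tw.
  - have : ltw (tw true (per0 p f)) (sh p be).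
      apply: (spl_ltE (p := p) (f := f) (e := 1%R) hp0).
      by apply: ltw_ext h => k; [rewrite starw_onesE|rewrite -beE].
    by move/ltwN; apply: ltw_ext => // k; rewrite tw_tw.
  - move=> b' j; have := orb (b' (+) true) (p + j).
    by apply: ltw_ext => // k; rewrite -tw_tw /tw /sh addnA.
have qE : q = m + i + p by rewrite /m /l; lia.
case: (posnP i) => [i0|i0].
  have bE : be =1 tw b Y by move=> k; rewrite /be i0.
  case: b @be hmax Wbe xb bz bef orb Lbe beE decM dec_m1 dec_m bE => be hmax Wbe xb bz bef orb Lbe beE decM dec_m1 dec_m bE.
    case: (ltw_asym xb); apply: (@ltw_trans (tw true X)).
      by apply: ltw_ext (ltwN XY) => // k; rewrite bE.
    by apply: ltw_ext (lexw_sh_lt true Lx hn hp0) => // k; rewrite /tw /sh XE.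
  rewrite qE i0 addn0; apply/DecPeriod/dec_m1.
  have [k k1 k2] : ltw be (per0 p f) by apply: ltw_ext YO.
  have b1 := sgnw_le1 p.-1 Wbe.
  have o1 : per0 p f p.-1 = (-1)%R by rewrite per0E // spl_mid.
  have hk : p.-1 <= k.
    rewrite leqNgt; apply/negP => h; move: k2.
    by rewrite bef // per0E // spl_lo // ltxx.
  case: (ltngtP k p.-1) hk => // [h|h] _; first by rewrite k1.
  by move: k2; rewrite h o1; lia.
have Yi : Y i.-1 = 1%R \/ Y i.-1 = (-1)%R by apply: WY.1; lia.
(* If this letter were 1, maximality would give [1 be < be], hence [be < sh 1 be], against
   lexicality of [be]. *)
have s0 : tw b Y i.-1 = (-1)%R.
  have [//|e] : tw b Y i.-1 = (-1)%R \/ tw b Y i.-1 = 1%R.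
    by rewrite /tw; case: (b); case: Yi => ->; auto.
  have E k : tw b (sh i.-1 Y) k.+1 = be k.
    by rewrite /be /tw /sh addnS -addSn prednK.
  exfalso; have [e'|[k k1 k2]] := hmax b i.-1 ltac:(lia).
    have := sgnw_eq_size (sgnw_tw b (sgnw_sh i.-1 WY)) Wbe _ _ e'.
    by rewrite /m; lia.
  case: k k1 k2 => [|k] k1 k2.
    move: k2; have -> : tw b (sh i.-1 Y) 0 = 1%R by rewrite -e /tw /sh addn0.
    by have := sgnw_le1 0 Wbe; lia.
  have : ltw be (sh 1 be).
    exists k => [c hc|]; rewrite -E; first by rewrite k1.
    by rewrite /sh add1n.
  have := lexw_sh_lt false Lbe ltac:(lia) (ltn0Sn 0).
  by move=> h /ltw_asym; apply.
pose Y' := cut i.-1 Y.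
have Y'lo k : k < i.-1 -> Y' k = Y k by rewrite /Y' /cut => ->.
have Y'hi k : i.-1 <= k -> Y' k = 0%R by rewrite /Y' /cut ltnNge => ->.
have zpm k : k < n.-1 -> z k = 1%R \/ z k = (-1)%R.
  move=> hk; rewrite /z /spl; case: ltnP => h; first by apply: Lf.1.1.
  case: eqP => h'; first by left.
  by rewrite /tw XE subnKC; [case: (Lx.1.1 k hk) => ->; auto|lia].
have s1 b' j : ltw (tw b' (sh j Y')) z.
  case: (ltnP j i.-1) => hj; last first.
    by exists 0 => //; rewrite z0 /tw /sh Y'hi ?oppr0 ?if_same //; lia.
  have [k k1 k2] := YZ b' j; rewrite -/z in k1 k2.
  pose d := i.-1 - j.
  have U'lo c : c < d -> tw b' (sh j Y') c = tw b' (sh j Y) c.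
    by move=> hc; rewrite /tw /sh Y'lo //; rewrite /d in hc; lia.
  have U'd : tw b' (sh j Y') d = 0%R.
    by rewrite /tw /sh Y'hi ?oppr0 ?if_same // /d; lia.
  case: (ltnP k d) => hk.
    by exists k => [c hc|]; rewrite U'lo //; [apply: k1|]; lia.
  exists d => [c hc|]; first by rewrite U'lo ?k1 //; lia.
  rewrite U'd; have [->//|zd] := zpm d ltac:(rewrite /d /l; lia).
  (* The 0 closing [Y'] faces a letter -1 of [z]. Then the letter of [Y] there has sign -1 as well,
     so [b' = b] and the suffix of [Y] at [j] continues with [be]. By maximality and [be < z] it
     agrees with [be] through place [d]; after that its remainder [be] beats the remainder of [be],
     so it exceeds the maximum. *)
  exfalso.
  have ud : tw b' (sh j Y) d = tw b' Y i.-1 by rewrite /tw /sh /d subnKC //; lia.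
  have um : tw b' Y i.-1 = (-1)%R.
    case: (ltngtP k d) hk => // [h _|h _]; first by rewrite -ud k1.
    by move: k2; rewrite h zd ud; have := sgnw_le1 i.-1 (sgnw_tw b' WY); lia.
  have bb : b' = b.
    by move: s0 um; rewrite /tw; case: (b); case: (b') => //; case: Yi => ->.
  have hdk : d < k.
    by case: (ltngtP k d) hk => // h _; move: k2; rewrite h ud um zd.
  have E : sh d.+1 (tw b' (sh j Y)) =1 be.
    by move=> c; rewrite bb /be /tw /sh (_ : j + (d.+1 + c) = i + c) // /d; lia.
  have agr c : c < d.+1 -> tw b' (sh j Y) c = be c.
    move=> hc; have hjl : j < l by lia.
    have [->//|[k' k1' k2']] := hmax b' j hjl.
    apply: (k1'); apply: leq_trans hc _; rewrite ltnNge; apply/negP => hk'.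
    have k'k : k' < k by lia.
    move: k2'; rewrite k1 // => hz.
    have [kk kk1 kk2] := bz.
    case: (ltngtP kk k') => hh.
    - by move: kk2; rewrite -k1' // k1 ?ltxx //; lia.
    - by move: hz; rewrite kk1 // ltxx.
    - by move: kk2; rewrite hh; lia.
  have hlt : ltw (sh d.+1 be) (sh d.+1 (tw b' (sh j Y))).
    apply: (ltw_ext _ (fun c => esym (E c)) (lexw_sh_lt false Lbe _ (ltn0Sn d))) => //.
    lia.
  have {hlt} := (ltw_sh (fun c hc => esym (agr c hc))).1 hlt => hlt.
  have [e|h] := hmax b' j ltac:(lia).
    by apply: (@ltw_irr be); apply: ltw_ext hlt.
  exact: ltw_asym hlt h.
have s2 : ltw X Y'.
  have [k k1 k2] := XY.
  case: (ltnP k i.-1) => hk.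
    by exists k => [c hc|]; rewrite Y'lo //; [apply: k1|]; lia.
  exists i.-1 => [c hc|]; first by rewrite Y'lo ?k1 //; lia.
  rewrite Y'hi //.
  have [Xi|->//] : X i.-1 = 1%R \/ X i.-1 = (-1)%R.
    by rewrite XE; apply: Lx.1.1; rewrite /l in hi; lia.
  (* Here [X] and [Y] agree through the removed letter 1, so [be] is the negative of the suffix of
     [Y] at [i]. It lies below the negative of the suffix of [X], hence below [x]. *)
  exfalso; have hk' : i.-1 < k.
    by case: (ltngtP k i.-1) hk => // h _; move: k2; rewrite h Xi; have := sgnw_le1 i.-1 WY; lia.
  have bT : b = true.
    by move: s0; rewrite /tw -k1 // Xi; case: (b).
  have : ltw (sh i X) (sh i Y).
    apply/(ltw_sh (k := i)); last by exists k.
    by move=> c hc; apply: k1; lia.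
  move/ltwN => h; apply: (ltw_asym xb); apply: (@ltw_trans (tw true (sh i X))).
    by apply: ltw_ext h => // c; rewrite /be bT.
  have := lexw_sh_lt true Lx hn (j := p + i) ltac:(lia).
  by apply: ltw_ext => // c; rewrite /tw /sh XE addnA.
have fin : ltw Y' (per0 p f) -> decomp p f X q.
  move=> s3; have dY : decomp p f X (i + p).
    apply: (IH _ _ Y'); [by lia|by lia|split=> //; first by lia].
    rewrite addnK; split=> c hc; last by apply: Y'hi.
    by rewrite Y'lo //; apply: WY.1; lia.
  rewrite qE -addnA; case: dec_m => [h|[e _ ->]]; first exact: DecSum.
  by rewrite addnC; apply: decomp_periods.
(* The bound fails for [Y'] only if [Y] agrees with the periodic word up to a letter -1 at [i - 1].
   Then [be] is below the periodic word from [i] on, so [x < be] forces [i] to be a multiple of [p]: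
   [Y] consists of copies of [f (-1)] followed by [be]. *)
have [k k1 k2] := YO.
case: (ltnP k i.-1) => hk.
  by apply: fin; exists k => [c hc|]; rewrite Y'lo //; [apply: k1|]; lia.
have o1 : per0 p f i.-1 = 1%R \/ per0 p f i.-1 = (-1)%R.
  rewrite /per0; case: eqP => h; first by right.
  by apply: Lf.1.1; have := ltn_pmod i.-1 hp0; lia.
case: o1 => o1.
  apply: fin; exists i.-1 => [c hc|]; first by rewrite Y'lo ?k1 //; lia.
  by rewrite Y'hi ?o1.
have hk' : i.-1 < k.
  case: (ltngtP k i.-1) hk => // h _; move: k2; rewrite h o1.
  by have := sgnw_le1 i.-1 WY; lia.
have bF : b = false.
  by move: s0; rewrite /tw k1 // o1; case: (b).
have blt : ltw be (sh i (per0 p f)).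
  have : ltw (sh i Y) (sh i (per0 p f)).
    apply/(ltw_sh (k := i)); last by exists k.
    by move=> c hc; apply: k1; lia.
  by apply: ltw_ext => // c; rewrite /be bF.
have [a [r [hr iE]]] := blockP i hp0.
have {}blt : ltw be (sh r (per0 p f)).
  apply: ltw_ext blt => // c; rewrite -[RHS](per0_sh p f a) /sh.
  by rewrite iE addnA.
case: (posnP r) => [r0|r0]; last first.
  case: (ltw_asym xb); apply: ltw_trans blt _.
  have [c [c1 c2 c3 c4]] := lexw_suffix_diff false Lf (c := r) ltac:(lia).
  have oE j : j < p.-1 - r -> sh r (per0 p f) j = tw false (sh r f) j.
    by move=> hj; rewrite /sh per0E // spl_lo //; lia.
  exists c => [j hj|]; first by rewrite oE ?c2 /x ?spl_lo //; lia.
  rewrite /x spl_lo ?c3; last lia.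
  case: (ltnP c (p.-1 - r)) => h; first by rewrite oE ?c4.
  by rewrite /sh per0E // (_ : r + c = p.-1) ?spl_mid //; lia.
have bm : be p.-1 = (-1)%R.
  have [j j1 j2] : ltw be (per0 p f) by apply: ltw_ext blt => // c; rewrite r0.
  have b1 := sgnw_le1 p.-1 Wbe.
  have o2 : per0 p f p.-1 = (-1)%R by rewrite per0E // spl_mid.
  have hj : p.-1 <= j.
    rewrite leqNgt; apply/negP => h; move: j2.
    by rewrite bef // per0E // spl_lo // ltxx.
  case: (ltngtP j p.-1) hj => // [h|h] _; first by rewrite j1.
  by move: j2; rewrite h o2; lia.
have -> : q = m + a.+1 * p by rewrite qE iE r0 mulSn; lia.
exact/decomp_periods/dec_m1.
Qed.

(** * Gluing lexical words *)

Lemma Forall_extract (T : Type) (P : T -> Prop) (R : T -> T -> Prop) s :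
  (forall a b, P a -> P b -> R a b \/ R b a) ->
  (forall a b c, R a b -> R b c -> R a c) ->
  s <> [::] -> List.Forall P s ->
  exists s1 e s2, [/\ s = s1 ++ e :: s2, P e, List.Forall P s1 /\ List.Forall P s2 &
    List.Forall (R e) s1 /\ List.Forall (R e) s2].
Proof.
move=> tot tr; elim: s => // c s IH _ /List.Forall_cons_iff [Pc Ps].
case: s IH Ps => [|d s] IH Ps.
  by exists [::], c, [::]; split=> //; split; constructor.
have [s1 [e [s2 [-> Pe [P1 P2] [R1 R2]]]]] := IH ltac:(by []) Ps.
have [h|h] := tot c e Pc Pe; last first.
  by exists (c :: s1), e, s2; split=> //; split=> //; constructor.
exists [::], c, (s1 ++ e :: s2); split=> //; split=> //.
  by apply/List.Forall_app; split=> //; constructor.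
apply/List.Forall_app; split; [|constructor=> //].
  by apply: List.Forall_impl R1 => g; apply: tr.
by apply: List.Forall_impl R2 => g; apply: tr.
Qed.

Lemma lew_tot n m u v : sgnw n u -> sgnw m v -> lew u v \/ lew v u.
Proof.
by move=> Wu Wv; have [h|h|h] := ltw_tri Wu Wv; [left; left|left; right|right; right].
Qed.

Lemma tw_sh_spl_ge m a e u b j : 0 < m ->
  tw b (sh (m + j) (spl m a e u)) =1 tw b (sh j u).
Proof. by move=> hm i; rewrite /tw /sh -addnA spl_hi. Qed.

Lemma lt_spl1 m a u : 0 < m -> sgnw m a -> ltw a (spl m a 1%R u).
Proof.
move=> hm [_ h]; exists m.-1 => [i hi|]; first by rewrite spl_lo.
by rewrite spl_mid h.
Qed.

(** The word is [a 1 (-e)]. A suffix at [j] that agrees with [a] to the end of [a] leaves [-e] to be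
    compared with the whole word from [m - j] on. The last hypothesis, negated, gives this
    comparison with [a], and the 1 in the place of the closing 0 makes it strict. *)
Lemma comb_lexw m k a e : 0 < m -> 0 < k -> lexw m a -> lexw k e -> lew e a ->
  (forall j, 0 < j < m -> lew (tw true (sh j a)) e) ->
  lexw (m + k) (spl m a 1%R (tw true e)).
Proof.
move=> hm hk La Le ea T; set c := spl m a _ _.
have ac : ltw a c by apply: lt_spl1 => //; apply: La.1.
have c0 : c 0 = 1%R.
  have [h|h] : m = 1 \/ 1 < m by lia.
    by rewrite /c h (spl_mid 1).
  by rewrite /c spl_lo ?(lexw_head La) //; lia.
have W : sgnw (m + k) c.
  split=> i hi; rewrite /c /spl.
    case: ltnP => h; first exact: La.1.1.
    case: eqP => h'; first by left.
    by apply: (sgnw_tw true Le.1).1; lia.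
  by rewrite ifF ?ifF ?(sgnw_tw true Le.1).2 //; lia.
split=> // b j hj.
case: (ltnP j m) => hjm; last first.
  have E : tw b (sh (m + (j - m)) c) =1 tw b (sh (j - m) (tw true e)) by apply: tw_sh_spl_ge.
  rewrite subnKC // in E.
  case: (posnP (j - m)) => j0; last first.
    apply: (ltw_trans _ (lew_ltw_trans ea ac)).
    apply: ltw_ext (Le.2 (b (+) true) (j - m) ltac:(lia)) => // i.
    by rewrite E -tw_tw.
  have E' i : tw b (sh j c) i = tw (~~ b) e i.
    by rewrite E j0 /tw /sh; case: (b); rewrite ?opprK.
  case: b E' {E} => E'.
    by apply: ltw_ext (lew_ltw_trans ea ac) => // i; rewrite E'.
  exists 0 => //; rewrite E' c0 /tw /=.
  have [h|h] : k = 1 \/ 1 < k by lia.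
    by rewrite Le.1.2 // h.
  by rewrite (lexw_head Le).
have [x [x1 x2 x3 x4]] := lexw_suffix_diff b La (c := j) ltac:(lia).
have lo i : i < m.-1 - j -> tw b (sh j c) i = tw b (sh j a) i.
  by move=> hi; rewrite /tw /sh /c spl_lo //; lia.
have agr i : i < x -> tw b (sh j c) i = c i.
  by move=> hi; rewrite lo ?x2 /c ?spl_lo //; lia.
have cx : c x = 1%R by rewrite /c spl_lo ?x3 //; lia.
case: (ltnP x (m.-1 - j)) => hx.
  by exists x => //; rewrite lo // x4 // cx.
have jx : j + x = m.-1 by lia.
have atx : tw b (sh j c) x = tw b (fun=> 1%R) 0 by rewrite /tw /sh jx /c spl_mid.
case: b x2 x4 lo agr atx => x2 x4 lo agr atx.
  by exists x => //; rewrite atx cx.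
have agr' i : i < x.+1 -> tw false (sh j c) i = c i.
  by rewrite ltnS leq_eqVlt => /orP [/eqP ->|/agr //]; rewrite atx cx.
apply/(ltw_sh agr'); apply: (@ltw_ext (tw true e) _ (sh (m - j) c)) => //.
- by move=> i; rewrite /tw /sh /c (_ : j + (x.+1 + i) = m + i) ?spl_hi //; lia.
- by move=> i; rewrite /sh; congr c; lia.
have h1 : lew (tw true e) (sh (m - j) a).
  case: (T (m - j)); first lia.
    by move=> h; left => i; rewrite -[RHS]opprK; congr (- _)%R; rewrite -h.
  by move/ltwN => h; right; apply: ltw_ext h => // i; rewrite tw_tw.
apply: (lew_ltw_trans h1); exists j.-1 => [i hi|].
  by rewrite /sh /c spl_lo //; lia.
by rewrite /sh (_ : m - j + j.-1 = m.-1) ?/c ?spl_mid ?La.1.2 //; lia.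
Qed.

(** Preserves the last hypothesis of [comb_lexw] for every further word that is at least [e].
    Negated suffixes starting in [a] drop where the closing 0 has become 1; the others are suffixes
    of [e]. *)
Lemma comb_tail m k a e : 0 < m -> lexw m a -> lexw k e ->
  (forall j, 0 < j < m -> lew (tw true (sh j a)) e) ->
  forall j, 0 < j < m + k -> lew (tw true (sh j (spl m a 1%R (tw true e)))) e.
Proof.
move=> hm La Le T j hj; set c := spl m a _ _.
case: (ltnP j m) => hjm; last first.
  have E : tw true (sh (m + (j - m)) c) =1 sh (j - m) e.
    by move=> i; rewrite tw_sh_spl_ge // /tw /sh opprK.
  rewrite subnKC // in E.
  case: (posnP (j - m)) => j0; first by left => i; rewrite E j0.
  right; apply: ltw_ext (Le.2 false (j - m) ltac:(lia)) => // i; by rewrite E.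
right; have lo i : i < m.-1 - j -> tw true (sh j c) i = tw true (sh j a) i.
  by move=> hi; rewrite /tw /sh /c spl_lo //; lia.
have atx : tw true (sh j c) (m.-1 - j) = (-1)%R.
  by rewrite /tw /sh subnKC ?/c ?spl_mid //; lia.
have ax : tw true (sh j a) (m.-1 - j) = 0%R.
  by rewrite /tw /sh La.1.2 ?oppr0 //; lia.
have [h|[x x1 x2]] := T j ltac:(lia).
  exists (m.-1 - j) => [i hi|]; first by rewrite lo.
  by rewrite atx -h ax.
case: (ltnP x (m.-1 - j)) => hx.
  by exists x => [i hi|]; rewrite lo // ?x1 //; lia.
exists (m.-1 - j) => [i hi|]; first by rewrite lo // x1 //; lia.
rewrite atx; case: (ltngtP x (m.-1 - j)) hx => // hx _.
  by rewrite -x1 // ax.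
by rewrite -hx; apply: le_lt_trans x2; rewrite hx ax.
Qed.

(* The words glued to [c] must be taken in increasing order, starting from
   their maximum as [c]. *)
Lemma glue_rest r m c (s : seq (nat * (nat -> int))) : size s = r ->
  0 < m -> lexw m c ->
  List.Forall (fun g => [/\ 0 < g.1, lexw g.1 g.2, lew g.2 c &
     forall j, 0 < j < m -> lew (tw true (sh j c)) g.2]) s ->
  exists c', [/\ lexw (m + sumn (map fst s)) c', lew c c' &
     forall i, i < m.-1 -> c' i = c i].
Proof.
elim: r m c s => [|r IH] m c s hs hm Lc Fs.
  by exists c; rewrite (size0nil hs) /= addn0; split=> //; left.
have tot : forall g h : nat * (nat -> int),
    [/\ 0 < g.1, lexw g.1 g.2, lew g.2 c & forall j, 0 < j < m -> lew (tw true (sh j c)) g.2] ->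
    [/\ 0 < h.1, lexw h.1 h.2, lew h.2 c & forall j, 0 < j < m -> lew (tw true (sh j c)) h.2] ->
    lew g.2 h.2 \/ lew h.2 g.2.
  by move=> g h [_ [Wg _] _ _] [_ [Wh _] _ _]; apply: lew_tot Wg Wh.
have tr : forall g h k : nat * (nat -> int), lew g.2 h.2 -> lew h.2 k.2 -> lew g.2 k.2.
  by move=> g h k; apply: lew_trans.
have sn : s <> [::] by move=> e; rewrite e in hs.
have [s1 [e [s2 [es [k0 Le ec Te] [P1 P2] [R1 R2]]]]] := Forall_extract tot tr sn Fs.
have Lc' := comb_lexw hm k0 Lc Le ec Te.
have cc' : ltw c (spl m c 1%R (tw true e.2)) by apply: lt_spl1 => //; apply: Lc.1.
have T' := comb_tail hm Lc Le Te.
have up : forall s', List.Forall (fun g => [/\ 0 < g.1, lexw g.1 g.2, lew g.2 c &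
     forall j, 0 < j < m -> lew (tw true (sh j c)) g.2]) s' ->
   List.Forall (fun g : nat * (nat -> int) => lew e.2 g.2) s' ->
   List.Forall (fun g => [/\ 0 < g.1, lexw g.1 g.2, lew g.2 (spl m c 1%R (tw true e.2)) &
     forall j, 0 < j < m + e.1 -> lew (tw true (sh j (spl m c 1%R (tw true e.2)))) g.2]) s'.
  move=> s' /List.Forall_forall h1 /List.Forall_forall h2; apply/List.Forall_forall => g hg.
  have [q0 Lg gc _] := h1 g hg; split=> //.
    by apply: lew_trans gc _; right.
  by move=> j hj; apply: lew_trans (T' j hj) (h2 g hg).
have [|||c' [h1 h2 h3]] := IH (m + e.1) _ (s1 ++ s2) _ _ Lc'.
- by move: hs; rewrite es !size_cat /=; lia.
- lia.
- by apply/List.Forall_app; split; apply: up.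
exists c'; split.
- move: h1; rewrite es !map_cat !sumn_cat /=; congr (lexw _ _); lia.
- by apply: lew_trans h2; right.
- by move=> i hi; rewrite h3 ?spl_lo //; lia.
Qed.

(** The last condition makes such words compatible: negated suffixes of one are below [x], hence
    below all the others. *)
Definition good (p : nat) (f x : nat -> int) (g : nat * (nat -> int)) : Prop :=
  [/\ p < g.1, lexw g.1 g.2, ltw x g.2,
      (forall i, i < p.-1 -> g.2 i = f i) /\ g.2 p.-1 = (-1)%R &
      forall j, 0 < j -> ltw (tw true (sh j g.2)) x].

Lemma glue p f x s : 0 < p -> s <> [::] -> List.Forall (good p f x) s ->
  exists a, [/\ lexw (sumn (map fst s)) a, ltw x a,
    forall i, i < p.-1 -> a i = f i & a p.-1 = (-1)%R].
Proof.
move=> hp sn Fs.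
have tot : forall g h, good p f x g -> good p f x h -> lew h.2 g.2 \/ lew g.2 h.2.
  by move=> g h [_ [Wg _] _ _ _] [_ [Wh _] _ _ _]; apply: lew_tot Wh Wg.
have tr : forall g h k : nat * (nat -> int), lew h.2 g.2 -> lew k.2 h.2 -> lew k.2 g.2.
  by move=> g h k h1 h2; apply: lew_trans h2 h1.
have [s1 [e [s2 [es [pm Le xe [e1 e2] Te] [P1 P2] [R1 R2]]]]] := Forall_extract tot tr sn Fs.
have up s' : List.Forall (good p f x) s' ->
   List.Forall (fun g : nat * (nat -> int) => lew g.2 e.2) s' ->
   List.Forall (fun g => [/\ 0 < g.1, lexw g.1 g.2, lew g.2 e.2 &
     forall j, 0 < j < e.1 -> lew (tw true (sh j e.2)) g.2]) s'.
  move=> /List.Forall_forall h1 /List.Forall_forall h2; apply/List.Forall_forall => g hg.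
  have [q0 Lg xg _ _] := h1 g hg; split=> //; [lia|exact: h2|].
  by move=> j hj; right; apply: ltw_trans xg; apply: Te; lia.
have [||c' [h1 h2 h3]] := @glue_rest _ e.1 e.2 (s1 ++ s2) erefl _ Le.
- lia.
- by apply/List.Forall_app; split; apply: up.
exists c'; split.
- move: h1; rewrite es !map_cat !sumn_cat /=; congr (lexw _ _); lia.
- exact: ltw_lew_trans xe h2.
- by move=> i hi; rewrite h3 ?e1 //; lia.
- by rewrite h3 ?e2 //; lia.
Qed.

(** A tail above [X] lowers the negated suffixes that start inside [f (-1)]. *)
Lemma spl_tail p f X Y : 1 < p -> lexw p f -> lexp p (spl p f (-1)%R X) ->
  ltw X Y -> (forall i, ltw (tw true (sh i Y)) (spl p f (-1)%R X)) ->
  forall j, 0 < j -> ltw (tw true (sh j (spl p f (-1)%R Y))) (spl p f (-1)%R X).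
Proof.
move=> hp Lf LX XY TY j j0; have hp0 : 0 < p by lia.
case: (ltnP j p) => hj; last first.
  apply: ltw_ext (TY (j - p)) => // i.
  by rewrite -[in RHS](subnKC hj) tw_sh_spl_ge.
apply: ltw_trans (LX true j _); last by rewrite j0.
have h : ltw (tw true (sh j (spl p f (-1)%R Y))) (tw true (sh j (spl p f (-1)%R X))).
  apply: ltwN; apply/ltw_sh; last exact: spl_lt.
  by move=> i hi; rewrite /spl; case: ltnP => // h; rewrite ifT //; lia.
exact: h.
Qed.

(** A decomposition becomes a list of good words of total length [q], ready for [glue]. For
    [DecPeriod] the first word [g] is replaced by [f (-1) g], which stays good because
    [g < f (-1) g] bounds its suffixes. *)
Lemma decomp_exists p n f X q : 1 < p -> lexw p f -> p < n ->
  lexw n (spl p f (-1)%R X) -> decomp p f X q ->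
  exists a, [/\ lexw q a, ltw (spl p f (-1)%R X) a,
    forall i, i < p.-1 -> a i = f i & a p.-1 = (-1)%R].
Proof.
move=> hp Lf hpn Lx; have hp0 : 0 < p by lia.
set x := spl p f _ X in Lx *; have hn : 1 < n by lia.
have LX : lexp p x by apply: lexw_lexp Lx; lia.
have Xx : ltw X x.
  apply: ltw_ext (lexw_sh_lt false Lx hn hp0) => // i.
  by rewrite /tw /sh /x spl_hi.
have x0 : x 0 = 1%R by apply: lexw_head Lx hn.
have spl_good q' Y : p < q' -> sgnw (q' - p) Y -> ltw X Y ->
    (forall b i, ltw (tw b (sh i Y)) (spl p f (-1)%R Y)) ->
    (forall i, ltw (tw true (sh i Y)) x) -> good p f x (q', spl p f (-1)%R Y).
  move=> hq WY XY orb TY; split=> //=.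
  - apply: (@spl_lexw p q' f true Y) => //; first lia.
    apply: (@lexp_interp p f true Y X Lf _ LX).
    by right; apply: ltwN XY.
  - exact: spl_lt.
  - by split=> [i hi|]; [rewrite spl_lo|rewrite spl_mid].
  - exact: spl_tail.
suff H : decomp p f X q -> exists s, [/\ s <> [::], List.Forall (good p f x) s &
    sumn (map fst s) = q].
  by move=> /H [s [h1 h2 <-]]; apply: glue.
elim=> {q} [q Y hq WY XY orb|q q' _ [s [s1 s2 s3]] _ [s' [s1' s2' s3']]|q _ [s [s1 s2 s3]]].
- exists [:: (q, spl p f (-1)%R Y)]; split=> //=; last by rewrite addn0.
  constructor=> //; apply: spl_good => //.
  by move=> b i; apply: ltw_trans (orb b i) _; apply: spl_lt.
- exists (s ++ s'); split.
  + by case: (s) s1.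
  + exact/List.Forall_app.
  + by rewrite map_cat sumn_cat s3 s3'.
case: s s1 s2 s3 => // g s _ /List.Forall_cons_iff [Pg Ps] /= <-.
exists ((g.1 + p, spl p f (-1)%R g.2) :: s); split=> //=; last lia.
constructor=> //; case: Pg => pg Lg xg [g1 g2] Tg.
have g0 : g.2 0 = 1%R by apply: lexw_head Lg _; lia.
have gs : ltw g.2 (spl p f (-1)%R g.2).
  have E : g.2 =1 spl p f (-1)%R (sh p g.2) by apply: splP.
  apply: (ltw_ext (fun i => esym (E i)) (fun i => erefl)).
  by apply: spl_lt => //; apply: (lexw_sh_lt false Lg); lia.
apply: spl_good.
- lia.
- by rewrite addnK; exact: Lg.1.
- exact: ltw_trans Xx xg.
- move=> b [|i]; last first.
    by apply: ltw_trans gs; apply: lexw_sh_lt Lg _ _; lia.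
  case: b; last by apply: ltw_ext gs.
  by exists 0 => //; rewrite spl_lo -?g1 /tw /sh ?addn0 ?g0 //; lia.
- move=> [|i]; last exact: Tg.
  by exists 0 => //; rewrite /tw /sh addn0 g0 x0.
Qed.

Lemma cand_exists p n f X Y : 1 < p -> lexw p f -> p < n ->
  lexw n (spl p f (-1)%R X) -> cand p f X n Y ->
  exists a, [/\ lexw n a, ltw (spl p f (-1)%R X) a,
    forall i, i < p.-1 -> a i = f i & a p.-1 = (-1)%R].
Proof.
move=> hp Lf hpn Lx /(decomp_cand hp Lf hpn Lx (leqnn n)).
exact: decomp_exists hp Lf hpn Lx.
Qed.

(** * Consecutive lexical words *)

Definition flip (d : nat) (x : nat -> int) : nat -> int :=
  fun i => if i < d then x i else (- x i)%R.

Definition ones (k : nat) : nat -> int := cut k.-1 (fun=> 1%R).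

Lemma ones_lexw k : lexw k (ones k).
Proof.
apply: lexw_of_runs.
- by split=> i hi; rewrite /ones /cut ?hi; [left|rewrite ltnNge hi].
- by move=> hk; rewrite /ones /cut ifT //; lia.
move=> t j hj; rewrite /tw /ones /cut; case: t; case: ifP => //; case: ifP => //.
Qed.

(** Suffixes that start in [-X] are, up to sign, suffixes of [f (-1) X] and hence less than it; only
    those starting in [f 1] need the hypothesis. *)
Lemma spl_flip_lexw p n f X : 0 < p < n -> lexw p f ->
  lexw n (spl p f (-1)%R X) -> lexp p (spl p f 1%R (tw true X)) ->
  lexw n (spl p f 1%R (tw true X)).
Proof.
move=> hpn Lf Lx LX; apply: (@spl_lexw p n f false) => //.
  apply: sgnw_tw; have := sgnw_sh p Lx.1; case=> h1 h2.
  by split=> i; [move/h1|move/h2]; rewrite /sh spl_hi //; lia.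
move=> b i hi; apply: ltw_trans (spl_lt_mid _ _ _ _).
have := lexw_sh_lt (b (+) true) Lx (j := p + i) ltac:(lia) ltac:(lia).
apply: ltw_ext => // k; rewrite -tw_tw /tw /sh -addnA spl_hi //; lia.
Qed.

(** The tail must have length [(n - 1) * p] and [U] has length [p], so [-U] is preceded by [n - 2]
    copies of [f (-1)]. As [-U] is less than every word beginning with [f], each copy raises the
    word. *)
Lemma free_tail_cand p n f X U : 1 < p -> 1 < n -> lexw p f ->
  lexw (n * p) (spl p f (-1)%R X) -> sgnw p U ->
  (forall b i Z, ltw (tw b (sh i U)) (spl p f 1%R Z)) ->
  (exists k, [/\ k < p.-1, forall i, i < k -> (- U i = f i)%R, U k = 1%R & f k = 1%R]) ->
  ltw X (tw true U) -> exists Y, cand p f X (n * p) Y.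
Proof.
move=> hp hn Lf Lx WU orbU [k0 [k1 k2 k3 k4]] XU; have hp0 : 0 < p by lia.
have f0 : f 0 = 1%R by apply: lexw_head Lf hp.
suff H k : exists T, [/\ sgnw (k.+1 * p) T, ltw X T, ltw T (spl p f (-1)%R T) &
    forall b i Z, ltw (tw b (sh i T)) (spl p f 1%R Z)].
  have [T [h1 h2 h3 h4]] := H (n - 2).
  exists T; split=> //.
  - by rewrite -[X in X < _]mul1n ltn_pmul2r.
  - have -> : n * p - p = (n - 2).+1 * p; last by [].
    by rewrite (_ : n = (n - 2).+2) ?mulSn ?addKn ?subSS ?subn0 //; lia.
  - exact: lt_per0.
elim: k => [|k [T [h1 h2 h3 h4]]].
  exists (tw true U); split=> //.
  - by rewrite mul1n; apply: sgnw_tw.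
  - exists k0 => [i hi|]; first by rewrite spl_lo /tw ?k2 //; lia.
    by rewrite spl_lo // /tw k3 k4.
  - move=> b i Z; apply: ltw_ext (orbU (b (+) true) i Z) => // j.
    by rewrite -tw_tw.
exists (spl p f (-1)%R T); split.
- apply: (@spl_sgnw p _ f true) => //; first by rewrite mulSn; have : 0 < k.+1 * p; [rewrite muln_gt0|]; lia.
  by rewrite mulSn addKn.
- exact: ltw_trans h3.
- exact: spl_lt.
have LT : lexp p (spl p f (-1)%R T).
  apply: (@lexp_interp p f true T X Lf); first by right; apply: ltwN h2.
  apply: lexw_lexp Lx; exact: leq_pmull (ltnW hn).
move=> b i Z; case: (ltnP i p) => hi; last first.
  by apply: ltw_ext (h4 b (i - p) Z) => // j; rewrite -[in RHS](subnKC hi) tw_sh_spl_ge.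
case: (posnP i) => [i0|i0]; last first.
  by apply: ltw_trans (LT b i _) (spl_lt_mid _ _ _ _); rewrite i0.
case: b; last by apply: ltw_ext (spl_lt_mid p f T Z) => // j; rewrite i0.
by exists 0 => //; rewrite /tw /sh i0 !spl_lo ?f0 //; lia.
Qed.

(** This makes [d] the end of a run of -1 in [x], that is of an even cell. Otherwise
    [1 (-1) 1 (-1) ...] would be a candidate tail: it exceeds [X] at the first letter, and no signed
    suffix of it begins with [1 1] as [f] does. *)
Lemma no_between_second n x y d : lexw n x -> lexw n y ->
  (forall z, lexw n z -> ltw x z -> ltw z y -> False) ->
  (forall i, i < d -> x i = y i) -> (x d < y d)%R ->
  x d.+1 <> (-1)%R.
Proof.
move=> Lx Ly nb e l xs; have [hd xd yd Lf] := lexw_cut Lx Ly e l.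
have fE i : i < d -> cut d x i = x i by rewrite /cut => ->.
have hd1 : d.+1 < n.-1.
  by rewrite ltnNge; apply/negP => h; have := Lx.1.2 d.+1 h; rewrite xs.
have d2 : 1 < d.
  case: d xd yd {e l Lf fE hd xs} hd1 => [|[|d]] //= xd yd hd1.
    by move: xd; rewrite (lexw_head Lx) //; lia.
  by move: xd; rewrite (lexw_second Lx) //; lia.
set f := cut d x in Lf fE; pose p := d.+1; pose X := sh p x.
have xE : x =1 spl p f (-1)%R X by apply: splP => // i /fE.
have f0 : f 0 = 1%R by apply: lexw_head Lf _; lia.
have f1 : f 1 = 1%R by apply: lexw_second Lf _; lia.
pose Y : nat -> int := cut (n - p).-1 (fun i => if odd i then (-1)%R else 1%R).
have Y01 b i : (tw b (sh i Y) 0 < 1)%R \/ (tw b (sh i Y) 1 < 1)%R.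
  rewrite /tw /sh addn0 addn1 /Y /cut /=.
  by case: b; case: (odd i); case: ifP; case: ifP => /=; auto.
have lt2 b i g : g 0 = 1%R -> g 1 = 1%R -> ltw (tw b (sh i Y)) g.
  move=> g0 g1; have WY : sgnw (n - p) Y.
    split=> k hk; rewrite /Y /cut; last by rewrite ltnNge hk.
    by rewrite hk; case: (odd k); auto.
  have le0 := sgnw_le1 0 (sgnw_tw b (sgnw_sh i WY)).
  have [h|h] : (tw b (sh i Y) 0 < 1)%R \/ tw b (sh i Y) 0 = 1%R by lia.
    by exists 0; rewrite ?g0.
  exists 1 => [[|k] // _|]; first by rewrite h.
  by rewrite g1; case: (Y01 b i) => //; rewrite h.
have cY : cand p f X n Y.
  split.
  - by rewrite /p; lia.
  - split=> k hk; rewrite /Y /cut; last by rewrite ltnNge hk.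
    by rewrite hk; case: (odd k); auto.
  - exists 0 => //; rewrite /X /sh addn0 xs /Y /cut /=.
    by case: ifP.
  - apply: (ltw_ext (fun i => erefl) (fun i => esym (per0E f (ltn0Sn d) i))).
    apply: (lt2 false 0); rewrite spl_lo //= ; lia.
  - by move=> b i; apply: lt2; rewrite spl_lo //=; lia.
have Lx' := lexw_ext xE Lx.
have hp : 1 < p by rewrite /p; lia.
have hpn : p < n by rewrite /p; lia.
have [a [La xa a1 a2]] := cand_exists hp Lf hpn Lx' cY.
apply: (nb a La); first by apply: ltw_ext xa => // i; rewrite xE.
exists d => [i hi|]; first by rewrite a1 // fE ?e.
by rewrite a2 yd.
Qed.

Lemma succ_structure n x y d : lexw n x -> lexw n y ->
  (forall z, lexw n z -> ltw x z -> ltw z y -> False) ->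
  (forall i, i < d -> x i = y i) -> (x d < y d)%R ->
  lexw n (flip d x) /\
  (if d.+1 %| n then exists b, [/\ lexw (n %/ d.+1) b, y =1 starw d.+1 (cut d x) b &
      forall b', lexw (n %/ d.+1) b' -> lew b b']
   else y =1 flip d x).
Proof.
move=> Lx Ly nb e l; have [hd xd yd Lf] := lexw_cut Lx Ly e l.
have fE i : i < d -> cut d x i = x i by rewrite /cut => ->.
have hn : 1 < n by lia.
have d1 : 0 < d.
  by case: (posnP d) => // d0; move: xd; rewrite d0 (lexw_head Lx).
set f := cut d x in Lf fE *; set p := d.+1 in Lf *; pose X := sh p x.
have hp : 1 < p by []. have hp0 : 0 < p by [].
have hpn : p < n by rewrite /p; lia.
have xE : x =1 spl p f (-1)%R X by apply: splP => // i /fE.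
have yf i : i < p.-1 -> y i = f i by move=> hi; rewrite fE // e.
pose E := sh p y; have yE : y =1 spl p f 1%R E by apply: splP => // i /yf.
have Lx' := lexw_ext xE Lx.
have flipE : spl p f 1%R (tw true X) =1 flip d x.
  move=> i; rewrite /flip xE /spl; case: ltnP => // h; case: eqP => // h'.
have flipL : lexp p (spl p f 1%R (tw true X)) -> lexw n (flip d x).
  by move=> h; apply: lexw_ext flipE _; apply: spl_flip_lexw => //; rewrite hp0.
have nbY Y : cand p f X n Y -> False.
  move=> cY; have [a [La xa a1 a2]] := cand_exists hp Lf hpn Lx' cY.
  apply: (nb a La); first by apply: ltw_ext xa => // i; rewrite xE.
  by exists d => [i hi|]; [rewrite a1 // fE ?e|rewrite a2 yd].
have xlt z : (forall i, i < p.-1 -> z i = f i) -> z p.-1 = 1%R -> ltw x z.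
  move=> h1 h2; exists d => [i hi|]; first by rewrite h1 ?fE.
  by rewrite xd (h2 : z d = _).
have WX : sgnw (n - p) X by apply: sgnw_sh Lx.1.
have [[k [b [nE Lb yfs]]]|h] := star_or_gt hp Lf Ly yf yd.
  have hk : 1 < k by move: hpn; rewrite nE; case: (k) => [|[|]] //; lia.
  split; last first.
    rewrite nE dvdn_mull // mulnK //; exists b; split=> // b' Lb'.
    have [h|h|h] := ltw_tri Lb.1 Lb'.1; [by left|by right|exfalso].
    have LB : lexw n (starw p f b') by rewrite nE; apply: starw_lexw => //; lia.
    apply: (nb _ LB).
      apply: xlt => [i hi|]; first by rewrite starw_first.
      by rewrite -[p.-1]add0n -(mul0n p) starw_last ?(lexw_head Lb').
    by apply: (ltw_ext (fun i => erefl) (fun i => esym (yfs i))); apply: starw_mono.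
  (* A product [y] gives no comparison with [-X], so [U] takes the role that the tail [E] of [y] has
     in the other case. *)
  have [U [WU LU orbU kU]] := free_tail hp Lf.
  have [h|h] : lew (tw true X) U \/ ltw X (tw true U).
    have [h|h|h] := ltw_tri (sgnw_tw true WX) WU; [by left; left|by left; right|right].
    by move/ltwN: h; apply: ltw_ext => // i; rewrite tw_tw.
    by apply/flipL/(@lexp_interp p f false _ U Lf _ LU).
  rewrite nE in Lx'; have [Y] := free_tail_cand hp hk Lf Lx' WU orbU kU h.
  by rewrite -nE => /nbY.
have ndvd : ~~ (p %| n).
  apply/negP => /dvdnP [k nE].
  have hk : 1 < k by move: hpn; rewrite nE; case: (k) => [|[|]] //; lia.
  have LB : lexw n (starw p f (ones k)).
    by rewrite nE; apply: starw_lexw (ones_lexw k) => //; lia.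
  apply: (nb _ LB).
    apply: xlt => [i hi|]; first by rewrite starw_first.
    by rewrite -[p.-1]add0n -(mul0n p) starw_last // /ones /cut ifT //; lia.
  apply: ltw_trans h; apply: starw_mono => //.
  exists k.-1 => [i hi|]; first by rewrite /ones /cut hi.
  by rewrite /ones /cut ltnn.
rewrite (negbTE ndvd).
have oE := starw_onesE f hp0.
have EO : ltw (tw true E) (per0 p f).
  have : ltw (tw true (per0 p f)) E.
    by apply: (spl_ltE (p := p) (f := f) (e := 1%R) hp0); apply: ltw_ext h.
  by move/ltwN; apply: ltw_ext => // k; rewrite tw_tw.
(* In the opposite case [-E] is a candidate tail: [y] exceeds all products, which is the periodic
   bound, and [y < f 1 (-X)] bounds the signed suffixes. *)
have XE : lew (tw true X) E.
  have WE : sgnw (n - p) E by apply: sgnw_sh Ly.1.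
  have [h'|h'|h'] := ltw_tri (sgnw_tw true WX) WE; [by left|by right|exfalso].
  apply: (nbY (tw true E)); split=> //.
  - exact: sgnw_tw.
  - by move/ltwN: h'; apply: ltw_ext => // i; rewrite tw_tw.
  move=> b i; apply: (@ltw_trans y).
    apply: ltw_ext (lexw_sh_lt (b (+) true) Ly hn (j := p + i) ltac:(lia)) => // k.
    by rewrite -tw_tw /E /tw /sh addnA.
  by apply: (ltw_ext (fun i => esym (yE i)) (fun i => erefl)); apply: spl_lt.
have Lfl : lexw n (flip d x).
  apply: flipL; apply: (@lexp_interp p f false _ E Lf) => //.
  by apply: lexp_ext yE _; apply: lexw_lexp Ly; lia.
split=> //; case: XE => [h' i|h'].
  by rewrite yE -flipE; apply: spl_ext => k; rewrite h'.
exfalso; apply: (nb _ Lfl).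
  apply: xlt => [i hi|]; first by rewrite /flip hi fE.
  by rewrite /flip ltnn xd.
by apply: (ltw_ext flipE (fun i => esym (yE i))); apply: spl_lt.
Qed.

(** * The least lexical word *)

Lemma starw1 f b : starw 1 f b =1 b.
Proof. by move=> i; rewrite /starw modn1 divn1 eqxx. Qed.

Lemma starw_assoc p q f g b : 0 < p -> 0 < q ->
  starw (q * p) (starw p f g) b =1 starw p f (starw q g b).
Proof.
move=> hp hq i; have [a [r [hr ->]]] := blockP i hp.
have [c [s [hs ->]]] := blockP a hq.
have hqp : 0 < q * p by rewrite muln_gt0 hq.
have -> : (c * q + s) * p + r = c * (q * p) + (s * p + r) by rewrite mulnDl addnA mulnA.
have lt1 : s < q.-1 -> s * p + r < (q * p).-1.
  move=> h; have : s.+2 * p <= q * p by rewrite leq_mul2r; lia.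
  by rewrite !mulSn; lia.
have qpE : (q * p).-1 = q.-1 * p + p.-1.
  by rewrite -{1}(prednK hq) mulSn; lia.
have [er|hr'] : r = p.-1 \/ r < p.-1 by lia.
  subst r; have [es|hs'] : s = q.-1 \/ s < q.-1 by lia.
    subst s; rewrite -qpE starw_last //.
    have -> : c * (q * p) + (q * p).-1 = (c * q + q.-1) * p + p.-1.
      by rewrite qpE mulnDl mulnA addnA.
    by rewrite !starw_last.
  have h := lt1 hs'.
  have E : c * (q * p) + (s * p + p.-1) = (c * q + s) * p + p.-1.
    by rewrite mulnDl mulnA addnA.
  rewrite [in RHS]E [in RHS]starw_last //.
  case: c {E} => [|c]; first by rewrite !mul0n !add0n starw_first // starw_last // starw_first.
  by rewrite !starw_mid // starw_last.
have h : s * p + r < (q * p).-1.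
  have : s * p <= q.-1 * p by rewrite leq_mul2r; lia.
  by rewrite qpE; lia.
have F j g' : starw p f g' (j * p + r) = if j == 0 then f r else (- g' j.-1 * f r)%R.
  by case: j => [|j] /=; [rewrite mul0n add0n starw_first|rewrite starw_mid].
have E : c * (q * p) + (s * p + r) = (c * q + s) * p + r.
  by rewrite mulnDl mulnA addnA.
rewrite [in RHS]E F; case: c {E} => [|c].
  rewrite mul0n add0n starw_first // F mul0n add0n.
  by case: eqP => // h0; rewrite starw_first //; lia.
have -> : (c.+1 * q + s == 0) = false by rewrite mulSn; lia.
rewrite starw_mid // F.
case: s hs {h lt1} => [|s] hs /=.
  rewrite (_ : (c.+1 * q + 0).-1 = c * q + q.-1) ?starw_last //.
  by rewrite mulSn; lia.
rewrite addnS /= starw_mid; last lia.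
by rewrite !(mulNr, mulrN, opprK) mulrA. 
Qed.

Lemma lt_ones_inf d b : 0 < d -> sgnw d b -> ltw b (fun=> 1%R).
Proof.
move=> hd Wb; have : b d.-1 <> 1%R by rewrite Wb.2.
move=> /(ltw_diff (v := fun=> 1%R)) [//|[k _ h]].
by have := sgnw_le1 k Wb; lia.
Qed.

Lemma lexw1 b : sgnw 1 b -> lexw 1 b.
Proof. by move=> W; split=> // t j; lia. Qed.

(** The word of the harmonic [h_l(0)], which is the star product of [h_{l-1}(0)] and (1); [ones 2]
    is the word of (1). *)
Fixpoint hw (l : nat) : nat -> int :=
  if l is l'.+1 then starw (2 ^ l') (hw l') (ones 2) else fun=> 0%R.

Lemma starw_lexw1 p d f b : 0 < p -> 0 < d -> lexw p f -> lexw d b ->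
  lexw (d * p) (starw p f b).
Proof.
move=> hp hd Lf Lb; have [p1|p1] : p = 1 \/ 1 < p by lia.
  by rewrite p1 muln1; apply: lexw_ext Lb => i; rewrite starw1.
exact: starw_lexw.
Qed.

Lemma hw_lexw l : lexw (2 ^ l) (hw l).
Proof.
elim: l => [|l IH] /=; first by apply: lexw1; split.
by rewrite expnS; apply: starw_lexw1 => //; [rewrite expn_gt0|apply: ones_lexw].
Qed.

Lemma starw_zero p f b : 0 < p -> sgnw p f -> sgnw 1 b -> starw p f b =1 f.
Proof.
move=> hp Wf [_ b0] i; have [a [r [hr ->]]] := blockP i hp.
have [er|hr'] : r = p.-1 \/ r < p.-1 by lia.
  by rewrite er starw_last // b0 ?Wf.2 //; lia.
case: a => [|a]; first by rewrite mul0n add0n starw_first.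
by rewrite starw_mid // b0 // oppr0 mul0r Wf.2 // mulSn; lia.
Qed.

(** In the induction, [y] is a product of [hw l] with a lexical word of length [2 * d]. For [d > 1]
    that word begins with [1 1], so [star_or_gt] for the word [1 0] splits off another factor 2 or
    places [y] above all products. *)
Lemma star_hw_or_gt l d y : 0 < d -> lexw (d * 2 ^ l) y ->
  (exists2 b, lexw d b & y =1 starw (2 ^ l) (hw l) b) \/
  ltw (starw (2 ^ l) (hw l) (fun=> 1%R)) y.
Proof.
elim: l d y => [|l IH] d y hd.
  by rewrite muln1 => Ly; left; exists y => // i; rewrite starw1.
have h2 : 0 < 2 ^ l by rewrite expn_gt0.
rewrite expnS mulnA => Ly.
have as_ b : starw (2 * 2 ^ l) (hw l.+1) b =1 starw (2 ^ l) (hw l) (starw 2 (ones 2) b).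
  by move=> i; rewrite starw_assoc.
have lt1 : ltw (starw 2 (ones 2) (fun=> 1%R)) (fun=> 1%R) by exists 2 => // [[|[|]]].
have [|[b Lb yb]|h] := IH (d * 2) y _ Ly; first by rewrite muln_gt0 hd.
  have [d1|d1] : d = 1 \/ 1 < d by lia.
    left; exists (fun=> 0%R); first by rewrite d1; apply: lexw1.
    move=> i; rewrite yb as_; apply: starw_ext => {}i.
    rewrite starw_zero //; last exact: (ones_lexw 2).1.
    subst d; case: i => [|i]; first by rewrite (lexw_head Lb).
    by rewrite Lb.1.2.
  have hb : 2 < d * 2 by lia.
  have b0 : b 0 = 1%R by apply: lexw_head Lb _; lia.
  have b1 : b 1 = 1%R by apply: lexw_second Lb _.
  have [|[d' [b' [e1 e2 e3]]]|h] := @star_or_gt 2 (d * 2) (ones 2) b isT (ones_lexw 2) Lb _ b1.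
  - by case.
  - left; exists b'; first by rewrite (_ : d = d') //; lia.
    by move=> i; rewrite yb as_; apply: starw_ext.
  - right; apply: (ltw_ext (fun i => esym (as_ _ i)) (fun i => esym (yb i))).
    exact: starw_mono.
right; apply: ltw_trans h.
by apply: (ltw_ext (fun i => esym (as_ _ i)) (fun i => erefl)); apply: starw_mono.
Qed.

(* For odd [d > 1], the word of (2, 1, ..., 1). *)
Definition sigma (d : nat) : nat -> int :=
  cut d.-1 (fun i => if odd i || (i == 0) then 1%R else (-1)%R).

Lemma sigma_lexw d : odd d -> lexw d (sigma d).
Proof.
move=> od; have W : sgnw d (sigma d).
  split=> i hi; rewrite /sigma /cut ?hi; last by rewrite ltnNge hi.
  by case: ifP; auto.
apply: lexw_of_runs => // [hd|t j hj h1 h2]; first by rewrite /sigma /cut ifT //; lia.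
have hd : 2 < d by case: d od hj {h1 h2 W} => [|[|[|d]]] //; lia.
exists 1 => [[|//] _|].
  by rewrite /sh /tw addn0 -/(tw t (sigma d) j) h2 /sigma /cut ifT //; lia.
have -> : sigma d 1 = 1%R by rewrite /sigma /cut ifT //; lia.
move: h1 h2; rewrite /sh /tw addn1 /sigma /cut.
case: j hj => // j hj /=.
by case: t; case: (odd j) => /=; do ?case: ifP => //=.
Qed.

(** The products with left factor [1 0] have supremum [1 1 (-1) 1 (-1) ...], of which [sigma d] is a
    truncation. They have even length, so for odd [d > 1] the word [b] exceeds the supremum. *)
Lemma sigma_least d b : odd d -> lexw d b -> lew (sigma d) b.
Proof.
move=> od Lb; have [d1|hd] : d = 1 \/ 2 < d.
- by case: d od {Lb} => [|[|[|d]]] //; auto.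
- left => i; rewrite Lb.1.2 ?d1 // /sigma /cut ifF //; lia.
have b0 : b 0 = 1%R by apply: lexw_head Lb _; lia.
have b1 : b 1 = 1%R by apply: lexw_second Lb _.
have [|[d' [b' [e1 _ _]]]|[k k1 k2]] := @star_or_gt 2 d (ones 2) b isT (ones_lexw 2) Lb _ b1.
- by case.
- by move: od; rewrite e1 oddM andbF.
have sE i : i < d.-1 -> sigma d i = starw 2 (ones 2) (fun=> 1%R) i.
  rewrite /sigma /cut => ->; rewrite /starw modn2 /=.
  case: i => [|[|i]] //=; rewrite negbK.
  by case: (odd i) => //=; rewrite /ones /cut /= mulr1.
have s0 i : d.-1 <= i -> sigma d i = 0%R by rewrite /sigma /cut ltnNge => ->.
case: (ltnP k d.-1) => hk.
  by right; exists k => [i hi|]; rewrite sE //; [apply: k1|]; lia.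
left => i; case: (ltnP i d.-1) => hi; last by rewrite s0 // Lb.1.2.
by rewrite sE // k1 //; lia.
Qed.

Definition muw (l d : nat) : nat -> int := starw (2 ^ l) (hw l) (sigma d).

Lemma muw_lexw l d : odd d -> lexw (d * 2 ^ l) (muw l d).
Proof.
move=> od; apply: starw_lexw1; rewrite ?expn_gt0 //; first by case: (d) od.
  exact: hw_lexw.
exact: sigma_lexw.
Qed.

Lemma muw_least l d y : odd d -> lexw (d * 2 ^ l) y -> lew (muw l d) y.
Proof.
move=> od Ly; have hd : 0 < d by case: (d) od.
have h2 : 0 < 2 ^ l by rewrite expn_gt0.
have [[b Lb yb]|h] := star_hw_or_gt hd Ly.
  have [h|h] := sigma_least od Lb.
    by left => i; rewrite yb; apply: starw_ext.
  by right; apply: (ltw_ext (fun i => erefl) (fun i => esym (yb i))); apply: starw_mono.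
right; apply: ltw_trans h; apply: starw_mono => //.
by apply: lt_ones_inf hd _; apply: (sigma_lexw od).1.
Qed.

(** * Words of sequences *)

Lemma Al_cons x a i : Al (x :: a) i = if i is j.+1 then (- Al a j)%R else x%:Z%R.
Proof. by case: i => [|i]; rewrite /Al /= ?expr0 ?mul1r // exprS mulN1r mulNr. Qed.

Lemma Al_nil i : Al [::] i = 0%R.
Proof. by rewrite /Al nth_nil mulr0. Qed.

Lemma Al_default a i : size a <= i -> Al a i = 0%R.
Proof. by move=> h; rewrite /Al nth_default ?mulr0. Qed.

Lemma alt_ltP a b : reflect (ltw (Al a) (Al b)) (alt_lt a b).
Proof.
rewrite /alt_lt; set p := fun j => (Al b j - Al a j != 0)%R.
set m := maxn (size b) (size a); have fE : first_nz b a = find p (iota 0 m) by [].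
have bef i : i < first_nz b a -> Al a i = Al b i.
  rewrite fE => hi; have hm : i < m.
    by apply: leq_trans hi _; rewrite -[X in _ <= X](size_iota 0 m) find_size.
  have := before_find 0 hi; rewrite nth_iota // add0n /p => /negbFE /eqP h; lia.
apply: (iffP idP) => [h|[d h1 h2]].
  by exists (first_nz b a) => //; lia.
have hd : first_nz b a = d.
  have dm : d < m.
    rewrite ltnNge; apply/negP => h; move: h2; rewrite !Al_default ?ltxx //.
      by apply: leq_trans h; rewrite leq_maxl.
    by apply: leq_trans h; rewrite leq_maxr.
  have hp : has p (iota 0 m).
    by apply/hasP; exists d; rewrite ?mem_iota // /p; lia.
  case: (ltngtP (first_nz b a) d) => // h.
    have := nth_find 0 hp; rewrite nth_iota -?fE ?add0n /p; last first.
      by rewrite fE -[X in _ < X](size_iota 0 m) -has_find.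
    by rewrite h1 // subrr eqxx.
  by move: h2; rewrite bef // ltxx.
by rewrite hd; lia.
Qed.

Lemma Al_tri a b : [\/ Al a =1 Al b, alt_lt a b | alt_lt b a].
Proof.
have [/forallP h|] := boolP [forall i : 'I_(size a + size b), Al a i == Al b i].
  constructor 1 => i; case: (ltnP i (size a + size b)) => hi.
    exact: (eqP (h (Ordinal hi))).
  by rewrite !Al_default //; lia.
move=> /forallPn [i /eqP /ltw_diff [] h]; [by constructor 2; apply/alt_ltP|].
by constructor 3; apply/alt_ltP.
Qed.

Definition positive (a : seq nat) : bool := all (fun x => 0 < x) a.

Lemma Al_inj a b : positive a -> positive b -> Al a =1 Al b -> a = b.
Proof.
elim: a b => [|x a IH] [|y b] //=.
- by move=> _ /andP [hy _] /(_ 0); rewrite Al_nil Al_cons; lia.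
- by move=> /andP [hx _] _ /(_ 0); rewrite Al_nil Al_cons; lia.
move=> /andP [_ ha] /andP [_ hb] e; congr (_ :: _).
  by have := e 0; rewrite !Al_cons; lia.
by apply: IH => // i; have := e i.+1; rewrite !Al_cons; lia.
Qed.

Fixpoint word (a : seq nat) : nat -> int :=
  if a is x :: a' then fun i => if i < x then 1%R else (- word a' (i - x)%N)%R
  else fun=> 0%R.

Lemma word_sgnw a : sgnw (sumn a).+1 (word a).
Proof.
elim: a => [|x a [h1 h2]] /=; first by split.
split=> i /= hi; case: ltnP => h; [by left| |lia|]; last by rewrite h2 ?oppr0 //=; lia.
by case: (h1 (i - x) ltac:(rewrite /=; lia)) => ->; rewrite ?opprK; auto.
Qed.

Lemma word0 a : positive a -> word a 0 = if a is [::] then 0%R else 1%R.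
Proof. by case: a => //= x a /andP [-> _]. Qed.

Lemma word0_ge0 a : positive a -> (0 <= word a 0 <= 1)%R.
Proof. by move=> /word0 ->; case: a. Qed.

(** Removing a common first cell negates what remains both in [Al] and in the word; hence the
    exchange of [a] and [b] in the induction. *)
Lemma word_mono k a b : size a + size b <= k -> positive a -> positive b ->
  ltw (Al a) (Al b) -> ltw (word a) (word b).
Proof.
elim: k a b => [|k IH] [|x a] [|y b] //=; try by move=> _ _ _ /ltw_irr.
- by move=> _ _ /andP [hy _] _; exists 0 => //=; rewrite hy.
- move=> _ /andP [hx _] _ [[|d] h1 h2].
    by move: h2; rewrite Al_nil Al_cons; lia.
  by have := h1 0 isT; rewrite Al_nil Al_cons; lia.
move=> hk /andP [hx ha] /andP [hy hb] h.
have [xy|xy] : x < y \/ x = y.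
- have [d h1 h2] := h; case: d h1 h2 => [|d] h1.
    by rewrite !Al_cons; lia.
  by have := h1 0 isT; rewrite !Al_cons; lia.
- exists x => [i hi|]; first by rewrite hi ifT //; lia.
  by rewrite ltnn xy subnn; have := word0_ge0 ha; lia.
subst y; have h' : ltw (Al b) (Al a).
  case: h => [[|d] h1 h2]; first by move: h2; rewrite !Al_cons ltxx.
  exists d => [i hi|]; last by move: h2; rewrite !Al_cons; lia.
  by have := h1 i.+1 hi; rewrite !Al_cons; lia.
have [d h1 h2] := IH b a ltac:(lia) hb ha h'.
exists (x + d) => [i hi|].
  by case: ltnP => // h3; rewrite h1 //; lia.
have xd : (x + d < x) = false by lia.
by rewrite xd addKn; lia.
Qed.

Lemma word_inj a b : positive a -> positive b -> word a =1 word b -> a = b.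
Proof.
move=> ha hb e; have [/(Al_inj ha hb) //|/alt_ltP h|/alt_ltP h] := Al_tri a b; exfalso.
  by apply: (@ltw_irr (word b)); apply: ltw_ext (word_mono (leqnn _) ha hb h).
apply: (@ltw_irr (word b)); apply: ltw_ext (word_mono (leqnn _) hb ha h) => //.
Qed.

Lemma alt_lt_word a b : positive a -> positive b -> reflect (ltw (word a) (word b)) (alt_lt a b).
Proof.
move=> ha hb; apply: (iffP idP) => [/alt_ltP|h]; first exact: word_mono.
have [/(Al_inj ha hb) e|//|/alt_ltP h'] := Al_tri a b.
  by case: (@ltw_irr (word b)); rewrite -{1}e.
by case: (ltw_asym h); apply: word_mono h'.
Qed.

Lemma word_onto n u : sgnw n u -> (1 < n -> u 0 = 1%R) ->
  exists2 a, positive a & word a =1 u.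
Proof.
elim/ltn_ind: n u => n IH u Wu u0.
have [hn|hn] := leqP n 1.
  by exists [::] => // i; rewrite /= Wu.2 //; lia.
have P0 : (u 0 == 1)%R by rewrite u0.
have Pn : ~~ (u (0 + n) == 1)%R by rewrite Wu.2 //; lia.
have [x [x1 x2 x3]] := run_end (P := fun i => (u i == 1)%R) P0 Pn.
have xn : x < n.
  rewrite ltnNge; apply/negP => h; have := x2 n.-1 ltac:(lia).
  by rewrite Wu.2 //.
have [|||a ha hu] := IH (n - x) _ (tw true (sh x u)).
- by lia.
- exact/sgnw_tw/sgnw_sh.
- move=> h; rewrite /tw /sh addn0; case: (Wu.1 x) => [|e|->] //; first lia.
  by rewrite e in x3.
exists (x :: a) => [|i] /=; first by rewrite x1.
case: ltnP => h; first by rewrite (eqP (x2 i h)).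
by rewrite hu /tw /sh subnKC // opprK.
Qed.

Lemma word_cat a b i : word (a ++ b) i =
  if i < sumn a then word a i else tw (odd (size a)) (word b) (i - sumn a).
Proof.
elim: a i => [|x a IH] i /=; first by rewrite subn0.
case: ltnP => h; first by rewrite ifT //; lia.
rewrite IH; have -> : (i < x + sumn a) = (i - x < sumn a) by lia.
case: ltnP => // h'; rewrite subnDA /tw; case: (odd _) => //=.
by rewrite opprK.
Qed.

Lemma word_drop j a : word (drop j a) =1 tw (odd j) (sh (sumn (take j a)) (word a)).
Proof.
move=> i; case: (leqP j (size a)) => hj.
  have := word_cat (take j a) (drop j a) (sumn (take j a) + i).
  rewrite cat_take_drop ltnNge leq_addr addKn size_take_min (minn_idPl hj) /= /tw /sh => ->.
  by case: (odd j); rewrite ?opprK.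
rewrite drop_oversize ?take_oversize; try lia.
by rewrite /tw /sh (word_sgnw a).2 ?oppr0 ?if_same //=; lia.
Qed.

(** Connects [lexw_of_runs] with lexical sequences: a run starts at a cell, and the sign that makes
    it positive is the parity of the number of cells before it. *)
Lemma word_run_start a t j : positive a -> 0 < j -> tw t (word a) j.-1 = (-1)%R ->
  tw t (word a) j = 1%R ->
  exists k, [/\ 0 < k < size a, j = sumn (take k a) & t = odd k].
Proof.
elim: a t j => [|x a IH] t j /=; first by rewrite /tw oppr0 if_same.
move=> /andP [hx ha] j0; rewrite {1 2}/tw /=.
case: (ltngtP j x) => hj.
- by have -> : (j.-1 < x) = true; [lia|case: (t)].
- have -> : (j.-1 < x) = false by lia.
  move=> h1 h2; have [|||k [k1 k2 k3]] := IH (~~ t) (j - x) ha.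
  + by lia.
  + by move: h1; rewrite /tw (_ : (j - x).-1 = j.-1 - x); [case: (t); rewrite ?opprK|lia].
  + by move: h2; rewrite /tw; case: (t); rewrite ?opprK.
  exists k.+1 => /=; split; [lia|lia|by rewrite -k3 negbK].
subst j; have -> : (x.-1 < x) = true by lia.
rewrite subnn; case: t => // _; rewrite opprK => h.
exists 1; split=> //=; last by rewrite take0 /= addn0.
by case: a ha h {IH}.
Qed.

Lemma sumn_take_lt k a : positive a -> 0 < k < size a -> 0 < sumn (take k a) < sumn a.
Proof.
move=> ha hk; have hd : 0 < sumn (drop k a).
  have hk' : k < size a by lia.
  by rewrite (drop_nth 0 hk') /= addn_gt0 (allP ha) ?mem_nth.
rewrite -{3}(cat_take_drop k a) sumn_cat; apply/andP; split; last lia.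
case: k hk {hd} => [|k] //; case: a ha => //= x a /andP [h _] _; lia.
Qed.

(** For [n = 1] the only sequence is (0), whose cell is not positive. *)
Lemma L_word n a : 1 < n ->
  reflect [/\ positive a, a != [::] & lexw n (word a)] (a \in L n).
Proof.
move=> hn; rewrite inE /lexical /alpha_seq; apply: (iffP idP).
  move=> /andP [/andP [/orP [/eqP ->|/andP [ha pa]] hl] /eqP hd]; first by move: hd; rewrite /degree /=; lia.
  have {}pa : positive a by [].
  split=> //; have W := word_sgnw a.
  rewrite (_ : n = (sumn a).+1); last by rewrite -hd /degree add1n.
  apply: lexw_of_runs => // [h|t j hj h1 h2].
    by rewrite word0 //; case: (a) ha.
  have j0 : 0 < j by lia.
  have [k [k1 k2 k3]] := word_run_start pa j0 h1 h2.
  have kin : k \in iota 1 (size a).-1 by rewrite mem_iota; lia.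
  have pd : positive (drop k a).
    by move: pa; rewrite /positive -{1}(cat_take_drop k a) all_cat => /andP [].
  have := allP hl k kin => /(alt_lt_word pd pa).
  by apply: ltw_ext => // i; rewrite word_drop k2 k3.
move=> [pa ha La].
have hd : n = (sumn a).+1 by apply: sgnw_eq_size La.1 (word_sgnw a) _ _ _ => //; lia.
apply/andP; split; last by rewrite /degree hd add1n.
rewrite ha -/(positive a) pa orbT /=; apply/allP => k; rewrite mem_iota => hk.
have pd : positive (drop k a).
  by move: pa; rewrite /positive -{1}(cat_take_drop k a) all_cat => /andP [].
apply/(alt_lt_word pd pa).
have := sumn_take_lt (k := k) pa ltac:(lia) => hs.
have := La.2 (odd k) (sumn (take k a)) ltac:(lia).
by apply: ltw_ext => // i; rewrite word_drop.
Qed.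

Lemma positive_cat a b : positive (a ++ b) = positive a && positive b.
Proof. exact: all_cat. Qed.

(** The last letter of an even cell is -1. Turned into 1, it forms a new cell if the cell had other
    letters, and joins the preceding cell otherwise. Either way the number of cells before the rest
    changes by one, which negates the rest. *)
Lemma elem_op_flip i a : positive a -> 0 < i <= size a -> ~~ odd i ->
  exists a', [/\ elem_op i a = Some a', positive a', a' != [::] &
    word a' =1 flip (sumn (take i a)).-1 (word a)].
Proof.
move=> pa hi ev.
have [j ei] : exists j, i = j.+2 by case: (i) hi ev => [|[|j]] // _ _; exists j.
subst i; have evj : odd j = false by move: ev; rewrite /= !negbK; case: odd.
pose u := take j a; pose d := nth 0 a j; pose c := nth 0 a j.+1; pose v := drop j.+2 a.
have aE : a = u ++ [:: d, c & v].
  rewrite /u /d /c /v -(drop_nth 0); last lia.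
  by rewrite -(drop_nth 0) ?cat_take_drop //; lia.
have su : size u = j by rewrite size_take_min; lia.
clearbody u d c v; subst a.
have pu : positive u by move: pa; rewrite positive_cat => /andP [].
have pc : 0 < d /\ 0 < c /\ positive v by move: pa; rewrite positive_cat /= => /and4P [].
case: pc => d0 [c0 pv].
have tE : take j.+2 (u ++ [:: d, c & v]) = u ++ [:: d; c].
  rewrite take_cat su ifF; last lia.
  by rewrite (_ : j.+2 - j = 2) //= ?take0 //; lia.
have dE : drop j.+2 (u ++ [:: d, c & v]) = v.
  rewrite drop_cat su ifF; last lia.
  by rewrite (_ : j.+2 - j = 2) //= ?drop0 //; lia.
have cE : cell (u ++ [:: d, c & v]) j.+2 = c.
  by rewrite /cell nth_cat su /= ltnNge leqnSn /= subSnn.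
have cE1 : cell (u ++ [:: d, c & v]) j.+1 = d.
  by rewrite /cell nth_cat su /= ltnn subnn.
have odu : odd (size u) = false by rewrite su.
rewrite tE sumn_cat /= addn0; set s := sumn u.
have flipE i : flip (s + (d + c)).-1 (word (u ++ [:: d, c & v])) i =
    if i < s then word u i else flip (d + c).-1 (word [:: d, c & v]) (i - s).
  rewrite /flip word_cat odu /tw -/s; case: ltnP => h; case: ltnP => h' //.
  - by rewrite ifT //; lia.
  - lia.
  - by rewrite ifF //; lia.
have [c1|c1] : c = 1 \/ 1 < c by lia.
  subst c; exists (u ++ d.+1 :: v); split.
  - rewrite /elem_op cE /= /conjugation cE1 dE /= take_cat su ltnn subnn take0 cats0 //.
  - by rewrite positive_cat /= pu pv.
  - by case: (u).
  move=> i; rewrite flipE word_cat odu /tw -/s; case: ltnP => // h.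
  rewrite /flip addn1 /=; set k := i - s.
  case: (ltngtP k d) => hk.
  - by rewrite ifT //; lia.
  - rewrite ifF; last lia.
    rewrite ifF; last lia.
    by rewrite opprK subnS -subn1 -subnDA addn1.
  by rewrite hk ltnSn subnn.
exists (u ++ [:: d, c.-1, 1 & v]); split.
- rewrite /elem_op cE c1 /= /splitting cE dE /=.
  rewrite take_cat su ifF; last lia.
  by rewrite (_ : j.+1 - j = 1) ?take0 //= -?catA //; lia.
- by rewrite positive_cat /= pu d0 pv /=; lia.
- by case: (u).
move=> i; rewrite flipE word_cat odu /tw -/s; case: ltnP => // h.
rewrite /flip /=; set k := i - s.
case: (ltnP k (d + c).-1) => hk.
  case: ltnP => // hk'; congr (- _)%R.
  by rewrite !ifT //; lia.
have -> : (k < d) = false by lia.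
have -> : (k - d < c.-1) = false by lia.
have -> : (k - d - c.-1 < 1) = (k - d < c) by lia.
case: ltnP => h'; rewrite !opprK //; congr (- _)%R; congr (word _ _); lia.
Qed.

Lemma word_first_diff_cons x y a b d : positive (x :: a) -> positive (y :: b) ->
  (forall i, i < d -> word (x :: a) i = word (y :: b) i) ->
  word (x :: a) d <> word (y :: b) d ->
  x <> y /\ d = minn x y \/ x = y /\ x <= d.
Proof.
move=> /= /andP [hx ha] /andP [hy hb] h1 h2.
have W a' : positive a' -> (- word a' 0 <> 1)%R by move=> /word0_ge0; lia.
case: (ltngtP x y) => hxy; [left|left|right].
- split; first lia.
  case: (ltngtP d x) => // h.
    by case: h2; rewrite !ifT //; lia.
  by have := h1 x h; rewrite ltnn subnn hxy => /W; case.
- split; first lia.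
  case: (ltngtP d y) => // h.
    by case: h2; rewrite !ifT //; lia.
  by have := h1 y h; rewrite ltnn subnn hxy => /esym /W; case.
split=> //; rewrite leqNgt; apply/negP => h; case: h2.
by rewrite !ifT //; lia.
Qed.

(** The words part where the shorter of the first two different cells ends, whence the minimum. *)
Lemma wedge_cut a b d : positive a -> positive b ->
  (forall i, i < d -> word a i = word b i) -> word a d <> word b d ->
  word a d <> 0%R -> word b d <> 0%R ->
  [/\ positive (wedge a b), wedge a b != [::] & word (wedge a b) =1 cut d (word a)].
Proof.
move=> pa pb h1 h2 h3 h4; rewrite /wedge ifF; last first.
  by apply/eqP => e; case: h2; rewrite e.
elim: a b d pa pb h1 h2 h3 h4 => [|x a IH] [|y b] d //.
move=> pa pb h1 h2 h3 h4.
case: (word_first_diff_cons pa pb h1 h2) => [[xy de]|[xy xd]].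
  rewrite /= maxnSS /= ifT; last exact/eqP.
  rewrite /=; move: pa pb => /= /andP [hx _] /andP [hy _].
  rewrite (_ : 0 < minn x y); last by rewrite leq_min hx.
  split=> // i; rewrite /= -de /cut; case: ltnP => h; last by rewrite oppr0.
  by rewrite ifT //; lia.
subst y; have pa' := pa; have pb' := pb.
move: pa pb => /= /andP [hx ha] /andP [hy hb].
rewrite maxnSS /= eqxx /= (iotaDl 1 0) find_map.
have dx : (d < x) = false by lia.
have [||||p1 p2 p3] := IH b (d - x) ha hb.
- move=> i hi; have := h1 (x + i) ltac:(lia).
  by rewrite /= (_ : (x + i < x) = false) ?addKn; lia.
- by move: h2; rewrite /= dx; lia.
- by move: h3; rewrite /= dx; lia.
- by move: h4; rewrite /= dx; lia.
split=> //; first by rewrite hx.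
move=> i; rewrite p3 /cut; case: ltnP => h; first by rewrite ifT //; lia.
have -> : (i - x < d - x) = (i < d) by lia.
by case: ifP; rewrite ?oppr0.
Qed.

(** * Words of star products and of the least sequences *)

Lemma incr_last_rcons u c : incr_last (rcons u c) = rcons u c.+1.
Proof. by rewrite /incr_last size_rcons last_rcons -(cats1 u c) take_size_cat. Qed.

Lemma word_incr_last a : positive a -> a != [::] ->
  [/\ size (incr_last a) = size a, sumn (incr_last a) = (sumn a).+1,
      forall i, i < sumn a -> word (incr_last a) i = word a i &
      word (incr_last a) (sumn a) = if odd (size a) then 1%R else (-1)%R].
Proof.
case/lastP: a => // u c; rewrite /positive all_rcons incr_last_rcons => /andP [hc pu] _.
rewrite -!cats1 !sumn_cat !size_cat /= !addn0 !addn1 addnS; split=> //.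
  move=> i hi; rewrite !word_cat; case: ltnP => // h.
  have hc1 : i - sumn u < c by lia.
  by rewrite /tw /= hc1 ltnS ltnW.
rewrite word_cat ltnNge leq_addr /=.
by rewrite addKn /tw /= ltnSn; case: (odd _).
Qed.

Lemma word_rcons1 a : [/\ size (rcons a 1) = (size a).+1, sumn (rcons a 1) = (sumn a).+1,
      forall i, i < sumn a -> word (rcons a 1) i = word a i &
      word (rcons a 1) (sumn a) = if odd (size a) then (-1)%R else 1%R].
Proof.
rewrite -cats1 sumn_cat size_cat /= !addn1; split=> //.
  by move=> i hi; rewrite word_cat hi.
by rewrite word_cat ltnn subnn /tw /=.
Qed.

(** The parity convention of [seq_o] puts the letter 1 in the place of the closing 0, and that of
    [seq_e] the letter -1. *)
Lemma word_seq_o f : positive f -> f != [::] ->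
  [/\ odd (size (seq_o f)), sumn (seq_o f) = (sumn f).+1,
      forall i, i < sumn f -> word (seq_o f) i = word f i & word (seq_o f) (sumn f) = 1%R].
Proof.
move=> pf nf; rewrite /seq_o; case: ifP => od.
  by have [h1 h2 h3 h4] := word_incr_last pf nf; split=> //; rewrite ?h1 // h4 od.
by have [h1 h2 h3 h4] := word_rcons1 f; split=> //; rewrite ?h1 /= ?od // h4 od.
Qed.

Lemma word_seq_e f : positive f -> f != [::] ->
  [/\ ~~ odd (size (seq_e f)), sumn (seq_e f) = (sumn f).+1,
      forall i, i < sumn f -> word (seq_e f) i = word f i & word (seq_e f) (sumn f) = (-1)%R].
Proof.
move=> pf nf; rewrite /seq_e; case: ifP => od.
  by have [h1 h2 h3 h4] := word_rcons1 f; split=> //; rewrite ?h1 /= ?od // h4 od.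
by have [h1 h2 h3 h4] := word_incr_last pf nf; split=> //; rewrite ?h1 ?od // h4 od.
Qed.

Lemma word_pow_e f k : positive f -> f != [::] ->
  [/\ ~~ odd (size (pow (seq_e f) k)), sumn (pow (seq_e f) k) = k * (sumn f).+1 &
      forall i, i < k * (sumn f).+1 -> word (pow (seq_e f) k) i = per0 (sumn f).+1 (word f) i].
Proof.
move=> pf nf; have [e1 e2 e3 e4] := word_seq_e pf nf.
elim: k => [|k [h1 h2 h3]]; first by split.
rewrite /pow /= -/(pow (seq_e f) k) size_cat oddD (negbTE e1) (negbTE h1) sumn_cat e2 h2.
split=> // i hi; rewrite word_cat e2 (negbTE e1) /tw.
rewrite per0E // /spl /=; case: (ltngtP i (sumn f)) => // [h|h|->]; last by rewrite ltnSn e4.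
  by rewrite ifT ?e3 //; lia.
by rewrite ifF ?h3 //; rewrite mulSn in hi; lia.
Qed.

(** A first cell [x] of [b] is a run of [x] letters 1, and its factor has the word [f 1 (-f) 1 ...]
    with [x] blocks. That factor has an odd number of cells, so what follows is negated, just as the
    letters of [b] after the run are. *)
Lemma word_star f b : positive f -> f != [::] -> positive b ->
  word (star f b) =1 starw (sumn f).+1 (word f) (word b).
Proof.
move=> pf nf; have f0 : (f == [:: 0]) = false.
  by apply/eqP => e; move: pf; rewrite e.
rewrite /star f0; set p := (sumn f).+1; have hp0 : 0 < p by [].
elim: b => [|x b IH] /=.
  by move=> _ i; rewrite starw_zero //; apply: word_sgnw.
move=> /andP [hx pb] i; have {}IH := IH pb.
have [o1 o2 o3 o4] := word_seq_o pf nf.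
have [q1 q2 q3] := word_pow_e x.-1 pf nf.
set B := seq_o f ++ _.
have sB : sumn B = x * p.
  by rewrite /B sumn_cat o2 q2 -mulSn prednK.
have oB : odd (size B) by rewrite /B size_cat oddD o1 (negbTE q1).
rewrite -catA word_cat sB oB; case: ltnP => h; last first.
  have hb : (tw true (word (x :: b)) x.-1 = -1)%R.
    by rewrite /tw /= ifT //; lia.
  have := starw_sh (word f) hp0 hx hb (i - x * p).
  rewrite {1}/tw /sh subnKC // => E.
  rewrite -[RHS]opprK E /tw; congr (- _)%R; rewrite IH.
  by apply: starw_ext => k; rewrite /= ifF ?opprK ?addKn //; lia.
have -> : starw p (word f) (word (x :: b)) i = starw p (word f) (fun=> 1%R) i.
  have [a [r [hr ei]]] := blockP i hp0; subst i.
  have ax : a < x.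
    by rewrite ltnNge; apply/negP => h'; have : x * p <= a * p; [rewrite leq_mul2r h' orbT|lia].
  have [er|hr'] : r = p.-1 \/ r < p.-1 by lia.
    by rewrite er !starw_last //= ax.
  case: a ax {h} => [|a] ax; first by rewrite mul0n add0n !starw_first.
  by rewrite !starw_mid //= ifT //; lia.
rewrite starw_onesE // /B word_cat o2 o1 /spl.
case: (ltngtP i p.-1) => [h'|h'|h'].
- by rewrite ifT ?o3 //; lia.
- rewrite ifF; last by rewrite /p; lia.
  rewrite /tw q3 //; move: h; rewrite -{1}(prednK hx) mulSn /p; lia.
by rewrite h' ltnSn o4.
Qed.

Lemma positive_incr_last a : positive a -> positive (incr_last a).
Proof.
case/lastP: a => // u c; rewrite incr_last_rcons /positive !all_rcons /=.
by case/andP.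
Qed.

Lemma positive_seq_o a : positive a -> positive (seq_o a).
Proof.
by move=> pa; rewrite /seq_o; case: ifP => _; [apply: positive_incr_last|rewrite /positive all_rcons].
Qed.

Lemma positive_seq_e a : positive a -> positive (seq_e a).
Proof.
by move=> pa; rewrite /seq_e; case: ifP => _; [rewrite /positive all_rcons|apply: positive_incr_last].
Qed.

Lemma positive_star f b : positive f -> f != [::] ->
  positive (star f b) /\ star f b != [::].
Proof.
move=> pf nf; have f0 : (f == [:: 0]) = false.
  by apply/eqP => e; move: pf; rewrite e.
rewrite /star f0; split; last by case: (f) nf => // y f' _; rewrite -size_eq0 size_cat addnS.
rewrite positive_cat pf andbT; elim: b => //= x b IH.
rewrite !positive_cat positive_seq_o // IH andbT /=.
by elim: (x.-1) => //= k IHk; rewrite positive_cat positive_seq_e.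
Qed.

Lemma harmonicSS l : positive (harmonic l.+1) ->
  harmonic l.+2 = star (harmonic l.+1) [:: 1].
Proof.
rewrite /star; case: eqP => [->//|_ _].
by rewrite /= !cats0.
Qed.

Lemma harmonic_word l : [/\ positive (harmonic l.+1), harmonic l.+1 != [::],
  sumn (harmonic l.+1) = (2 ^ l.+1).-1 & word (harmonic l.+1) =1 hw l.+1].
Proof.
have one : word [:: 1] =1 ones 2 by case.
elim: l => [|l [h1 h2 h3 h4]].
  by split=> // i; rewrite /= -[LHS]/(word [:: 1] i) one starw1.
have [p1 p2] := positive_star [:: 1] h1 h2.
have w : word (harmonic l.+2) =1 hw l.+2.
  move=> i; rewrite harmonicSS // word_star //.
  have -> : (sumn (harmonic l.+1)).+1 = 2 ^ l.+1 by rewrite h3 prednK // expn_gt0.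
  change (hw l.+2) with (starw (2 ^ l.+1) (hw l.+1) (ones 2)).
  by rewrite /starw one h4; case: ifP => // _; rewrite one h4.
rewrite (harmonicSS h1) in w *; split=> //.
have := sgnw_eq_size (word_sgnw _) (hw_lexw l.+2).1 isT _ w => /(_ ltac:(by rewrite expn_gt0)).
by move=> <-.
Qed.

(** Here [s] is the [s - 1] of [mu_of], whence the shift in the length. *)
Lemma word_sigma s : word (2 :: nseq (2 * s) 1) =1 sigma (2 * s.+1).+1.
Proof.
have alt k i : word (nseq k 1) i = if i < k then ((-1) ^+ i)%R else 0%R.
  elim: k i => //= k IH [|i] //=.
  by rewrite subn1 /= IH ltnS exprS; case: ifP => _; rewrite ?mulN1r ?oppr0.
move=> i; rewrite /= alt /sigma /cut /=.
have h : 1 < 2 * s.+1 by lia.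
case: i => [|[|i]]; [by rewrite (ltnW h)|by rewrite h|].
rewrite /= subn2 /= (_ : (i.+2 < 2 * s.+1) = (i < 2 * s)); last lia.
case: ifP => _; rewrite ?oppr0 // negbK.
by rewrite orbF -signr_odd; case: (odd i); rewrite ?expr1 ?expr0 ?opprK.
Qed.

(** The hypothesis excludes [mu 1], which is (0). For [s = 0] the second factor is the word [0] of
    length 1, and the product is the harmonic. *)
Lemma word_mu_of l s : 0 < l + s ->
  [/\ positive (mu_of l s), mu_of l s != [::] & word (mu_of l s) =1 muw l (2 * s).+1].
Proof.
rewrite /mu_of /muw; case: s => [|s] ls.
  case: l ls => // l _; have [h1 h2 h3 h4] := harmonic_word l.
  split=> // i; rewrite h4 starw_zero ?expn_gt0 //; exact: (hw_lexw l.+1).1.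
rewrite /= subn1 /=.
have pb : positive (2 :: nseq (2 * s) 1) by rewrite /= /positive all_nseq orbT.
case: l {ls} => [|l].
  rewrite /star /=; split=> // i.
  by rewrite starw1 -word_sigma.
have [h1 h2 h3 h4] := harmonic_word l; have [p1 p2] := positive_star (2 :: nseq (2 * s) 1) h1 h2.
split=> // i; rewrite word_star // h3 prednK ?expn_gt0 //.
by rewrite /starw !h4 !word_sigma.
Qed.

Lemma mu_least_word n : 1 < n -> [/\ positive (mu n), mu n != [::], lexw n (word (mu n)) &
  forall y, lexw n y -> lew (word (mu n)) y].
Proof.
move=> hn; have [l [s nE]] : exists l s, n = 2 ^ l * (2 * s + 1).
  have [t ct nE] := pfactor_coprime (isT : prime 2) (ltnW hn).
  exists (logn 2 n), t./2; rewrite {1}nE mulnC; congr (_ * _).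
  rewrite coprime2n in ct; rewrite -{1}(odd_double_half t) ct.
  by rewrite add1n addn1 mul2n.
have ls : 0 < l + s.
  rewrite lt0n addn_eq0; apply/negP => /andP [/eqP l0 /eqP s0].
  by move: hn; rewrite nE l0 s0.
have [h1 h2 h3] := word_mu_of ls.
have nE' : n = (2 * s).+1 * 2 ^ l by rewrite nE mulnC addn1.
have od : odd (2 * s).+1 by rewrite /= mul2n odd_double.
rewrite nE muE; rewrite -nE nE'; split=> //.
  by apply: lexw_ext (muw_lexw l od) => i; rewrite h3.
move=> y /(muw_least od) [e|h]; [left|right].
  by move=> i; rewrite h3.
by apply: ltw_ext h.
Qed.

(** * The procedure *)

Lemma word_cell_end i a : positive a -> 0 < i <= size a ->
  0 < sumn (take i a) /\ tw (~~ odd i) (word a) (sumn (take i a)).-1 = 1%R.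
Proof.
case: i => // j pa /= hj; have hp : 0 < nth 0 a j by rewrite (allP pa) ?mem_nth.
rewrite (take_nth 0) // sumn_rcons; split; first lia.
have := word_drop j a (nth 0 a j).-1; rewrite (drop_nth 0) //= ifT; last lia.
by rewrite negbK /tw /sh -subn1 addnBA // subn1 => <-.
Qed.

Lemma sumn_take_mono i j a : positive a -> 0 < i < j -> j <= size a ->
  sumn (take i a) < sumn (take j a).
Proof.
move=> pa hij hj; have pt : positive (take j a).
  by move: pa; rewrite -{1}(cat_take_drop j a) positive_cat => /andP [].
have := sumn_take_lt (k := i) pt; rewrite size_take_min (minn_idPl hj).
move=> /(_ hij) /andP [_]; by rewrite take_takel //; lia.
Qed.

Lemma word_minus_run_end a d : positive a -> word a d = (-1)%R -> word a d.+1 <> (-1)%R ->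
  exists i, [/\ ~~ odd i, 0 < i <= size a & sumn (take i a) = d.+1].
Proof.
move=> pa h1 h2; have W := word_sgnw a.
have ds : d < sumn a.
  by rewrite ltnNge; apply/negP => h; have := W.2 d h; rewrite h1.
have [h|h] : d.+1 = sumn a \/ d.+1 < sumn a by lia.
  have sa : 0 < size a by case: (a) h.
  have [_ h'] := @word_cell_end (size a) a pa ltac:(by rewrite sa /=).
  exists (size a); rewrite take_size leqnn sa h; split=> //.
  by move: h'; rewrite take_size -h /= /tw h1; case: (odd _).
have e : word a d.+1 = 1%R by case: (W.1 d.+1) => //=.
have [k [k1 k2 k3]] := @word_run_start a false d.+1 pa isT h1 e.
by exists k; split; [rewrite -k3|lia|].
Qed.

Lemma op_in_L_flip n a i : 1 < n -> positive a -> 0 < i <= size a -> ~~ odd i ->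
  op_in_L n a i -> lexw n (flip (sumn (take i a)).-1 (word a)).
Proof.
move=> hn pa hi ev; have [a' [h1 h2 h3 h4]] := elem_op_flip pa hi ev.
rewrite /op_in_L h1 => /(L_word _ hn) [_ _]; exact: lexw_ext.
Qed.

Lemma last_filter_iota (P : pred nat) m i : 0 < i <= m -> P i ->
  (forall j, i < j <= m -> ~~ P j) -> last 0 [seq j <- iota 1 m | P j] = i.
Proof.
move=> hi Pi hP; have -> : m = i.-1 + (1 + (m - i)) by lia.
rewrite !iotaD !filter_cat !last_cat /= (_ : 1 + i.-1 = i) ?Pi /=; last lia.
rewrite (eq_in_filter (a2 := pred0)) ?filter_pred0 // => j.
by rewrite mem_iota => hj; apply/negbTE/hP; lia.
Qed.

Lemma adjacent_no_between n a c : 1 < n -> adjacent (L n) a c ->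
  positive a -> positive c ->
  forall z, lexw n z -> ltw (word a) z -> ltw z (word c) -> False.
Proof.
move=> hn [_ nb] pa pc z Lz az zc.
have z0 := lexw_head Lz hn.
have [b pb bz] := word_onto Lz.1 (fun _ => z0).
apply: nb; exists b; last first.
  apply/andP; split; [apply/(alt_lt_word pa pb)|apply/(alt_lt_word pb pc)].
    by apply: ltw_ext az.
  by apply: ltw_ext zc.
apply/L_word => //; split=> //; last exact: lexw_ext Lz.
by apply/eqP => b0; have := bz 0; rewrite b0 z0.
Qed.

Lemma divn_gt1 p n : p %| n -> p < n -> 1 < n %/ p.
Proof.
case: p => [|p]; first by rewrite dvd0n => /eqP ->.
by move=> /dvdnP [k ->]; rewrite mulnK //; case: k => [|[|k]] //; lia.
Qed.

(** An operation on a later even cell keeps the letters up to [d] and raises a later letter -1, so a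
    lexical result would lie between [a] and [c]. *)
Lemma step_cell_run_end n a c d i : 1 < n -> positive a ->
  (forall z, lexw n z -> ltw (word a) z -> ltw z (word c) -> False) ->
  (forall i, i < d -> word a i = word c i) -> (word a d < word c d)%R ->
  ~~ odd i -> 0 < i <= size a -> sumn (take i a) = d.+1 -> op_in_L n a i ->
  step_cell n a = i.
Proof.
move=> hn pa nb e l ev hi si opi.
apply: last_filter_iota; rewrite ?hi ?ev //.
move=> j hj; apply/negP => /andP [evj opj].
have hj' : 0 < j <= size a by lia.
have Lz := op_in_L_flip hn pa hj' evj opj.
have [s0 se] := word_cell_end pa hj'.
have sm := @sumn_take_mono i j a pa ltac:(lia) ltac:(lia).
have dD : d < (sumn (take j a)).-1 by rewrite si in sm; lia.
apply: (nb _ Lz).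
  exists (sumn (take j a)).-1 => [k hk|]; first by rewrite /flip hk.
  by rewrite /flip ltnn; move: se; rewrite evj /tw; lia.
exists d => [k hk|]; last by rewrite /flip dD.
by rewrite /flip (ltn_trans hk dD) e.
Qed.

Lemma step_adjacent n a c : 1 < n -> a \in L n -> c \in L n -> adjacent (L n) a c ->
  (exists a', [/\ step_op n a = Some a', a' \in L n, alt_lt a a' &
     wedge a a' \in L (1 + degree (wedge a a'))]) /\ next_seq n a = Some c.
Proof.
move=> hn /(L_word _ hn) [pa na La] /(L_word _ hn) [pc nc Lc] adj.
have nb := adjacent_no_between hn adj pa pc.
have [/(alt_lt_word pa pc) [d e l] _] := adj.
have [hd xd yd Lf] := lexw_cut La Lc e l.
have hsec := no_between_second La Lc nb e l.
have [Lfl str] := succ_structure La Lc nb e l.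
have d0 : 0 < d by case: (posnP d) => // d0; move: xd; rewrite d0 (lexw_head La).
have [i [ev hi si]] := word_minus_run_end pa xd hsec.
have [a' [op pa' na' wa']] := elem_op_flip pa hi ev.
rewrite si /= in wa'.
have a'L : a' \in L n by apply/L_word => //; split=> //; apply: lexw_ext Lfl.
have cellE : step_cell n a = i.
  by apply: (step_cell_run_end hn pa nb e l ev hi si); rewrite /op_in_L op.
have sop : step_op n a = Some a' by rewrite /step_op cellE.
have wa'd : word a' d = 1%R by rewrite wa' /flip ltnn xd opprK.
have agr k : k < d -> word a k = word a' k by rewrite wa' /flip => ->.
have [pf nf wf] : [/\ positive (wedge a a'), wedge a a' != [::] &
    word (wedge a a') =1 cut d (word a)].
  by apply: wedge_cut; rewrite // ?xd ?wa'd.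
have df : degree (wedge a a') = d.
  have := sgnw_eq_size (word_sgnw (wedge a a')) Lf.1 isT isT wf.
  by case.
split.
  exists a'; split=> //.
    apply/(alt_lt_word pa pa'); exists d => //.
    by rewrite xd wa'd.
  by rewrite df; apply/L_word => //; split=> //; apply: lexw_ext Lf.
rewrite /next_seq sop /= /step_next df add1n; congr Some.
move: str; rewrite /dvdn lt0n; case: eqP => hr /=; last first.
  by move=> h; apply: word_inj => // k; rewrite wa' h.
move=> [b [Lb yb bmin]].
have hk : 1 < n %/ d.+1.
  by apply: divn_gt1; [rewrite /dvdn hr|rewrite -ltnS (ltn_predK hn) in hd].
have [pm nm Lm mmin] := mu_least_word hk.
have bm : b =1 word (mu (n %/ d.+1)).
  case: (bmin _ Lm) => // h1; case: (mmin _ Lb) => [h2 k|h2]; first by rewrite h2.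
  by case: (ltw_asym h1 h2).
apply: word_inj => //; first by have [] := positive_star (mu (n %/ d.+1)) pf nf.
move=> k; rewrite word_star // yb -[sumn _]/(degree (wedge a a')) df.
by rewrite /starw !wf !bm.
Qed.

(** * Extreme elements and enumeration of [L n] *)

Lemma single_greatest n : 1 < n -> greatest (L n) [:: n.-1].
Proof.
move=> hn; have p1 : positive [:: n.-1] by rewrite /positive /=; lia.
have w1 : word [:: n.-1] =1 ones n.
  by move=> i; rewrite /= /ones /cut oppr0.
have Lo := ones_lexw n.
split; first by apply/L_word => //; split=> //; apply: lexw_ext Lo.
move=> b /(L_word _ hn) [pb nb Lb]; rewrite /alt_le.
have [h|h|h] := ltw_tri Lb.1 Lo.1.
- by rewrite (word_inj pb p1) ?eqxx // => i; rewrite h.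
- by apply/orP; right; apply/(alt_lt_word pb p1); apply: ltw_ext h.
case: h => d h1; have := sgnw_le1 d Lb.1; rewrite /ones /cut; case: ltnP => h2.
  by move=> h3 h4; lia.
by rewrite Lb.1.2 ?ltxx.
Qed.

Lemma mu_least n : 1 < n -> least (L n) (mu n).
Proof.
move=> hn; have [pm nm Lm mmin] := mu_least_word hn.
split; first by apply/L_word.
move=> b /(L_word _ hn) [pb nb Lb]; rewrite /alt_le; case: (mmin _ Lb) => h.
  by rewrite (word_inj pm pb) ?eqxx.
by apply/orP; right; apply/(alt_lt_word pm pb).
Qed.

Lemma alt_lt_irr a : alt_lt a a = false.
Proof. by apply/negP => /alt_ltP /ltw_irr. Qed.

Lemma alt_lt_trans : transitive alt_lt.
Proof.
by move=> b a c /alt_ltP h1 /alt_ltP h2; apply/alt_ltP; apply: ltw_trans h2.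
Qed.

(** Sorting calls for a relation that is total on all lists. [alt_le] is not: [[::]] and [[:: 0]]
    are different lists with the same [Al]. *)
Definition not_gt (a b : seq nat) : bool := ~~ alt_lt b a.

Lemma not_gtP a b : reflect (Al a =1 Al b \/ alt_lt a b) (not_gt a b).
Proof.
rewrite /not_gt; apply: (iffP idP) => [h|].
  by have [e|e|e] := Al_tri a b; [left|right|rewrite e in h].
case=> [h|h]; apply/negP => h'.
  by apply: (@ltw_irr (Al a)); move/alt_ltP: h'; apply: ltw_ext.
by have := alt_lt_trans h h'; rewrite alt_lt_irr.
Qed.

Lemma not_gt_trans : transitive not_gt.
Proof.
move=> b a c /not_gtP [h1|h1] /not_gtP [h2|h2]; apply/not_gtP.
- by left => i; rewrite h1.
- by right; apply/alt_ltP; move/alt_ltP: h2; apply: ltw_ext.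
- by right; apply/alt_ltP; move/alt_ltP: h1; apply: ltw_ext.
- by right; apply: alt_lt_trans h2.
Qed.

Lemma not_gt_total : total not_gt.
Proof.
move=> a b; apply/orP; have [h|h|h] := Al_tri a b.
- by left; apply/not_gtP; left.
- by left; apply/not_gtP; right.
- by right; apply/not_gtP; right.
Qed.

Fixpoint bounded_seqs (m k : nat) : seq (seq nat) :=
  if k is k'.+1 then [::] :: [seq x :: a | x <- iota 0 m, a <- bounded_seqs m k']
  else [:: [::]].

Lemma mem_bounded_seqs m k a : size a <= k -> all (fun x => x < m) a ->
  a \in bounded_seqs m k.
Proof.
elim: k a => [|k IH] [|x a] //= hs /andP [hx ha].
by rewrite inE /=; apply/allpairs_f; [rewrite mem_iota|apply: IH].
Qed.

Lemma L_bounded n a : a \in L n -> a \in bounded_seqs n.+1 n.+1.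
Proof.
rewrite inE => /andP [/andP [h _] /eqP hd]; apply: mem_bounded_seqs.
  case/orP: h hd => [/eqP -> _ //|/andP [_ pa]] hd.
  have : size a <= sumn a.
    elim: a pa {hd} => //= x a IH /andP [hx ha].
    by have := IH ha; lia.
  by rewrite /degree in hd; lia.
apply/allP => x hx; have : x <= sumn a.
  elim: a hx {h hd} => //= y a IH; rewrite inE => /orP [/eqP ->|/IH h].
    by rewrite leq_addr.
  by apply: leq_trans h _; rewrite leq_addl.
by rewrite /degree in hd; lia.
Qed.

Theorem mainTheorem3 (n : nat) (hn : 0 < n) :
  least (L n) (mu n) /\
  greatest (L n) [:: n.-1] /\
  exists s : seq (seq nat),
    [/\ complete_run n s,
        (forall a, a \in s -> a <> [:: n.-1] ->
           exists a', [/\ step_op n a = Some a', a' \in L n, alt_lt a a' &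
                          wedge a a' \in L (1 + degree (wedge a a'))]),
        s =i L n,
        sorted alt_lt s &
        forall j, j.+1 < size s ->
          adjacent (L n) (nth [::] s j) (nth [::] s j.+1)].
Proof.
(* The encoding by words covers [n > 1] only. *)
have [n1|{}hn] : n = 1 \/ 1 < n by lia.
  subst n; have L1 a : (a \in L 1) = (a == [:: 0]).
    apply/idP/eqP => [|-> //]; rewrite inE => /andP [/andP [h _] /eqP hd].
    case/orP: h => [/eqP //|/andP [na pa]]; case: a na pa hd => //= x a _ /andP [hx _].
    by rewrite /degree /=; lia.
  have mu1 : mu 1 = [:: 0] by rewrite (muE 0 0).
  rewrite mu1 /=; split; [|split].
  - by split=> [|b]; rewrite L1 // => /eqP ->.
  - by split=> [|b]; rewrite L1 // => /eqP ->.
  exists [:: [:: 0]]; split=> //.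
  - by move=> a; rewrite inE => /eqP ->.
  - by move=> a; rewrite L1 inE.
have Lmin := mu_least hn; have Lmax := single_greatest hn.
split=> //; split=> //.
(* The run is the sorted list of [L n]: its consecutive elements are adjacent, and [step_adjacent]
   recognises each as the successor the procedure computes. Termination then needs no argument of
   its own. *)
pose s := sort not_gt (undup [seq a <- bounded_seqs n.+1 n.+1 | a \in L n]).
have memS a : (a \in s) = (a \in L n).
  rewrite mem_sort mem_undup mem_filter andbC.
  by apply/andP/idP => [[]//|h]; split=> //; apply: L_bounded.
have uS : uniq s by rewrite sort_uniq undup_uniq.
have sS : sorted not_gt s by apply: sort_sorted; apply: not_gt_total.
have nthL j : j < size s -> nth [::] s j \in L n by move=> h; rewrite -memS mem_nth.
have ltS i j : i < j -> j < size s -> alt_lt (nth [::] s i) (nth [::] s j).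
  move=> ij hj; have hi : i < size s by apply: ltn_trans hj.
  have := sorted_ltn_nth not_gt_trans [::] sS i j hi hj ij.
  case/not_gtP => // e; have /(L_word _ hn) [pi _ _] := nthL i hi.
  have /(L_word _ hn) [pj _ _] := nthL j hj.
  have /eqP := Al_inj pi pj e; rewrite nth_uniq // => /eqP e'.
  by rewrite e' ltnn in ij.
have idx a : a \in L n -> exists2 j, j < size s & a = nth [::] s j.
  by rewrite -memS => h; exists (index a s); rewrite ?index_mem ?nth_index.
have adj j : j.+1 < size s -> adjacent (L n) (nth [::] s j) (nth [::] s j.+1).
  move=> hj; split; first exact: ltS.
  move=> [c /idx [k hk ->] /andP [h1 h2]].
  case: (ltngtP k j) => h.
  - by have := alt_lt_trans h1 (ltS _ _ h (ltnW hj)); rewrite alt_lt_irr.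
  - case: (ltngtP k j.+1) => h'; [lia| |by rewrite h' alt_lt_irr in h2].
    by have := alt_lt_trans h2 (ltS _ _ h' hk); rewrite alt_lt_irr.
  - by rewrite h alt_lt_irr in h1.
have s0 : 0 < size s by have [j hj _] := idx _ Lmin.1; apply: leq_ltn_trans hj.
have lastE : last [::] s = [:: n.-1].
  have [j hj jE] := idx _ Lmax.1.
  have [h|h] : j = (size s).-1 \/ j < (size s).-1 by lia.
    by rewrite -nth_last jE h.
  have hl : (size s).-1 < size s by lia.
  have := ltS _ _ h hl; rewrite -jE => h1.
  case/orP: (Lmax.2 _ (nthL _ hl)) => [/eqP e|h2]; first by rewrite e alt_lt_irr in h1.
  by have := alt_lt_trans h1 h2; rewrite alt_lt_irr.
have notlast j : j.+1 < size s -> nth [::] s j != [:: n.-1].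
  move=> hj; apply/eqP => e; have h1 := ltS _ _ (ltnSn j) hj; rewrite e in h1.
  case/orP: (Lmax.2 _ (nthL _ hj)) => [/eqP e'|h2]; first by rewrite e' alt_lt_irr in h1.
  by have := alt_lt_trans h1 h2; rewrite alt_lt_irr.
have stp j (hj : j.+1 < size s) := step_adjacent hn (nthL j (ltnW hj)) (nthL _ hj) (adj j hj).
exists s; split=> //.
- split=> //.
    have [j hj jE] := idx _ Lmin.1.
    have -> : ohead s = Some (nth [::] s 0) by case: (s) s0.
    congr Some; case: (posnP j) => [j0|j0]; first by rewrite jE j0.
    have h1 := ltS _ _ j0 hj; rewrite -jE in h1.
    case/orP: (Lmin.2 _ (nthL _ s0)) => [/eqP -> //|h2].
    by have := alt_lt_trans h1 h2; rewrite alt_lt_irr.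
  apply/(sortedP [::]) => j hj; rewrite notlast //=.
  by have [_ ->] := stp j hj.
- move=> a; rewrite memS => /idx [j hj ->] ne.
  have hj1 : j.+1 < size s.
    have [h|//] : j = (size s).-1 \/ j.+1 < size s by lia.
    by case: ne; rewrite h nth_last.
  by have [] := stp j hj1.
- by apply/(sortedP [::]) => j hj; apply: ltS.
Qed.
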